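(* Let $k$ be an algebraically closed field of characteristic zero, let $f\in R=k[x,y,z]$ be a homogeneous polynomial of degree $d+1\geq 2$, let $X=V(f)\subset\mathbb P^2_k$, and let $e:=\operatorname{indeg}(\operatorname{Syz}(J_f))$. Supposing that $f$ is irreducible, one has: (i) If $f$ is not a free divisor then $\operatorname{Bour}(X)\geq e(e-d)+d$. (ii) If $f$ is a free divisor then $e\geq 2$ and $d\geq 4$; in particular, there are no irreducible free divisors of degree $2\leq d+1\leq 4$. Moreover, if $f$ is a free divisor and $d+1=5$ then $e=2$. (iii) If $d\geq 2$ and $\operatorname{Bour}(X)=1$ then $e<d$.
   Context: $J_f=(f_x,f_y,f_z)\subset R$ is the gradient ideal. $\operatorname{Syz}(J_f)=\{(a,b,c)\in R^3: af_x+bf_y+cf_z=0\}$ is graded as a submodule of $R^3$ (a syzygy has degree $n$ if its coordinates are forms of degree $n$). For a graded module $M=\bigoplus_{i\ge 0}M_i$, $\operatorname{indeg}(M)=\min\{i: M_i\ne 0\}$. The curve $X$ (or $f$) is a free divisor if $\operatorname{Syz}(J_f)$ is a free $R$-module. Bourbaki degree: let $e=\operatorname{indeg}(\operatorname{Syz}(J_f))$. If $f$ is a free divisor, set $\operatorname{Bour}(X)=0$. Otherwise choose a minimal generator $\epsilon\in\operatorname{Syz}(J_f)$ of degree $e$; the cokernel of $R(-e)\stackrel{\epsilon}{\to}\operatorname{Syz}(J_f)$ is isomorphic, by a degree-zero graded isomorphism, to $I_\epsilon(e-d)$ for a proper homogeneous ideal $I_\epsilon\subset R$ of codimension two, and $\operatorname{Bour}(X):=\deg(R/I_\epsilon)$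 (algebraic multiplicity), which does not depend on the choice of $\epsilon$ of degree $e$. *)

(* Defs.v *)
From mathcomp Require Import all_boot all_order all_algebra ring_quotient.
From mathcomp Require Export mpoly.

Set Implicit Arguments.
Unset Strict Implicit.
Unset Printing Implicit Defensive.

Import GRing.Theory.
Local Open Scope ring_scope.

Definition irreducible_elt (A : idomainType) (p : A) : Prop :=
  [/\ p != 0, p \isn't a GRing.unit &
      forall a b : A, p = a * b ->
        a \is a GRing.unit \/ b \is a GRing.unit].

(* Ideals are boolean predicates satisfying the library's [idealr_closed],
   which includes properness (1 \notin I). *)

Definition is_prime_ideal (A : nzRingType) (P : {pred A}) : Prop :=
  idealr_closed P /\ prime_idealr_closed P.

(* A strict chain C 0 < C 1 < ... < C n = P of prime ideals. *)
Definition prime_chain_to (A : nzRingType) (P : {pred A}) (n : nat) : Prop :=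
  exists C : nat -> {pred A},
    [/\ forall i, (i <= n)%N -> is_prime_ideal (C i),
        forall i, (i < n)%N ->
          {subset C i <= C i.+1} /\
          exists2 x, x \in C i.+1 & x \notin C i
      & C n =i P].

(* Truncating a chain from below leaves a chain, so it is enough to exclude
   the length h + 1. *)
Definition is_prime_height (A : nzRingType) (P : {pred A}) (h : nat) : Prop :=
  prime_chain_to P h /\ ~ prime_chain_to P h.+1.

Definition is_codim (A : nzRingType) (I : {pred A}) (h : nat) : Prop :=
  (exists P : {pred A},
     [/\ is_prime_ideal P, {subset I <= P} & is_prime_height P h]) /\
  (forall P : {pred A}, is_prime_ideal P -> {subset I <= P} ->
     prime_chain_to P h).

Section Forms.

Variable k : fieldType.
Local Notation R := {mpoly k[3]}.

Definition homog_ideal (I : {pred R}) : Prop :=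
  forall p : R, p \in I -> forall n : nat, pihomog mdeg n p \in I.

(* dim_k (R/I)_n = h, witnessed by forms of degree n that are a k-basis of
   R_n modulo I_n. *)
Definition is_hilbert_value (I : {pred R}) (n h : nat) : Prop :=
  exists b : 'I_h -> R,
    [/\ forall i, b i \is n.-homog,
        forall c : 'I_h -> k,
          \sum_(i < h) c i *: b i \in I -> forall i, c i = 0
      & forall p : R, p \is n.-homog ->
          exists c : 'I_h -> k, p - \sum_(i < h) c i *: b i \in I].

(* Multiplicity of R/I: (deg P)! times the leading coefficient of the Hilbert
   polynomial P, or the total length when R/I has finite length (P = 0). *)
Definition is_multiplicity (I : {pred R}) (m : nat) : Prop :=
  exists (H : nat -> nat) (P : {poly rat}) (N : nat),
    [/\ forall n, is_hilbert_value I n (H n),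
        forall n, (N <= n)%N -> (H n)%:R = P.[n%:R]
      & if P == 0 then m = (\sum_(i < N) H i)%N
        else m%:R = lead_coef P * ((size P).-1)`!%:R].

(* Forms of integral degree; there is only 0 in negative degrees. *)
Definition is_form (j : int) (p : R) : Prop :=
  match j with
  | Posz n => p \is n.-homog
  | Negz _ => p = 0
  end.

(* The elements of degree n of a graded submodule M of R^3. *)
Definition graded_piece (M : {pred 'rV[R]_3}) (n : nat) (s : 'rV[R]_3) : Prop :=
  s \in M /\ forall i, s 0 i \is n.-homog.

Definition is_indeg (M : {pred 'rV[R]_3}) (e : nat) : Prop :=
  (exists2 s, graded_piece M e s & s != 0) /\
  (forall n, (n < e)%N -> forall s, graded_piece M n s -> s = 0).

(* R is noetherian, so a basis of a free submodule of R^3 is finite. *)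
Definition is_free_module (M : {pred 'rV[R]_3}) : Prop :=
  exists (r : nat) (b : 'I_r -> 'rV[R]_3),
    [/\ forall i, b i \in M,
        forall s, s \in M -> exists c : 'I_r -> R, s = \sum_(i < r) c i *: b i
      & forall c : 'I_r -> R,
          \sum_(i < r) c i *: b i = 0 -> forall i, c i = 0].

(* Membership in the submodule (x, y, z)M. *)
Definition in_irrelevant_mul (M : {pred 'rV[R]_3}) (v : 'rV[R]_3) : Prop :=
  exists (r : nat) (c : 'I_r -> R) (s : 'I_r -> 'rV[R]_3),
    [/\ forall i, (c i)@_0%MM = 0, forall i, s i \in M
      & v = \sum_(i < r) c i *: s i].

Definition minimal_generator (M : {pred 'rV[R]_3}) (n : nat) (v : 'rV[R]_3) :
  Prop := graded_piece M n v /\ ~ in_irrelevant_mul M v.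

Definition syz (f : R) : {pred 'rV[R]_3} :=
  [pred s : 'rV[R]_3 | \sum_(i < 3) s 0 i * f^`M(i) == 0].

Definition free_divisor (f : R) : Prop := is_free_module (syz f).

(* A degree-zero graded isomorphism M / R eps ~ I(a), given as a map phi
   that is R-linear on M, has kernel R eps and image I, and sends M_n into
   I(a)_n = I_(n + a). The values of phi outside M are irrelevant. *)
Definition coker_iso_shift (M : {pred 'rV[R]_3}) (eps : 'rV[R]_3)
    (I : {pred R}) (a : int) : Prop :=
  exists phi : 'rV[R]_3 -> R,
    [/\ forall (c : R) (s t : 'rV[R]_3), s \in M -> t \in M ->
          phi (c *: s + t) = c * phi s + phi t,
        forall s, s \in M -> (phi s = 0 <-> exists c : R, s = c *: eps),
        forall p : R, p \in I <-> exists2 s, s \in M & phi s = p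
      & forall n s, graded_piece M n s -> is_form (n%:Z + a) (phi s)].

Definition is_bourbaki_ideal (f : R) (d e : nat) (eps : 'rV[R]_3)
    (I : {pred R}) : Prop :=
  [/\ idealr_closed I, homog_ideal I, is_codim I 2
    & coker_iso_shift (syz f) eps I (e%:Z - d%:Z)].

(* Bour(V(f)) = b, for f of degree d + 1, as a relation: b is the value
   obtained from some choice of eps and of I_eps. *)
Definition is_bour (f : R) (d b : nat) : Prop :=
  (free_divisor f /\ b = 0%N) \/
  (~ free_divisor f /\
   exists (e : nat) (eps : 'rV[R]_3) (I : {pred R}),
     [/\ is_indeg (syz f) e, minimal_generator (syz f) e eps,
         is_bourbaki_ideal f d e eps I & is_multiplicity I b]).

End Forms.

(* Main.v *)
(* Write e for indeg Syz(J_f). Irreducible forms of k[x,y,z] are prime (Gauss),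
   f is not a cone, so e >= 1, and the Koszul syzygies give e <= d.

   The cross product of two syzygies is a multiple of grad f. If Syz(J_f) is
   free, primality of f makes the cross product of a basis a nonzero constant
   times grad f; taking homogeneous parts, a syzygy eps of degree e has a
   partner eta of degree d - e with eps x eta = c grad f, whence 2e <= d. If
   moreover e = 1, then eps is a linear field v |-> v A annihilating f, and
   f vanishes at every eigenvector of A (at p with p A = 0 because grad f does).
   On an invariant plane f restricts to a nonzero binary form, which forces the
   eigenvalues of A there to be nonzero of opposite sign, or both zero with a
   Jordan block. Hence A is a single nilpotent block, its orbits are parabolas
   on conics, and f is divisible by one of these conics, so d = 1: contradiction.

   Multiplicities are at least 1 and e(e - d) + d <= 1 for 1 <= e < d, so in (i)
   and (iii) only e = d matters. There R/I has the Hilbert function of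
   R/((f_x,f_y) : f_z), which is bounded by d^2; this colon ideal contains no
   form of degree < d and some linear form l is a nonzerodivisor modulo it, so
   its Hilbert function is at least dim R_(d-1) >= d from degree d on. *)

Require Import Defs.
From mathcomp Require Import all_boot all_order all_algebra.
From mathcomp Require Import ring zify.
From HB Require Import structures.
From Stdlib Require Import Classical.
Import GRing.Theory.
Local Open Scope ring_scope.

Set Implicit Arguments.
Unset Strict Implicit.
Unset Printing Implicit Defensive.
Import Num.Theory Order.TTheory.

(** * Unique factorization *)

(** Primality of f enters through an identity of degree two in f. Writing the Koszul syzygies in a
    basis b1, b2 gives D (b1 x b2) = (d+1) f grad f, and pairing with the Euler field gives D W =
    ((d+1) f)^2, where W has no constant term; this forces f to divide D. The equation eps x eta = c
    grad f does more than bound e: it makes f singular wherever eps vanishes.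

    For e = d the obstacle is that eps and I_eps are not explicit. But R eps takes a copy of R_(n-d)
    out of Syz(J_f)_n, so dim (R/I)_n depends only on dim R_n, dim R_(n-d) and dim Syz(J_f)_n. The
    Koszul syzygy (-f_y, f_x, 0) has the degree of eps and may stand in for it, the last coordinate
    replacing the isomorphism: this is where the colon ideal comes from. The constant d^2 is the
    second difference of dim R_n with step d. Boundedness makes the Hilbert polynomial constant, so
    the multiplicity is a value of the Hilbert function. *)

Definition divides (A : idomainType) (a b : A) : Prop := exists c, b = a * c.

Definition prime_elt (A : idomainType) (p : A) : Prop :=
  [/\ p != 0, p \isn't a GRing.unit &
      forall a b : A, divides p (a * b) -> divides p a \/ divides p b].

Definition factorial_ring (A : idomainType) : Prop :=
  forall a : A, a != 0 -> exists (u : A) (s : seq A),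
    [/\ u \is a GRing.unit, (forall p, p \in s -> prime_elt p)
      & a = u * \prod_(p <- s) p].

Section Divisibility.
Variable A : idomainType.
Implicit Types a b c f g h p u : A.

Lemma divides_mull a b c : divides a b -> divides a (c * b).
Proof. by case=> x ->; exists (c * x); ring. Qed.

Lemma divides_mulr a b c : divides a b -> divides a (b * c).
Proof. by case=> x ->; exists (x * c); ring. Qed.

Lemma dividesD a b c : divides a b -> divides a c -> divides a (b + c).
Proof. by move=> [x ->] [y ->]; exists (x + y); ring. Qed.

Lemma divides_trans a b c : divides a b -> divides b c -> divides a c.
Proof. by move=> [x ->] [y ->]; exists (x * y); ring. Qed.

Lemma divides_unit a u : divides a u -> u \is a GRing.unit -> a \is a GRing.unit.
Proof. by move=> [x ->]; rewrite unitrM => /andP[]. Qed.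

Lemma prime_irreducible p : prime_elt p -> irreducible_elt p.
Proof.
case=> p0 pU pP; split=> // a b pab.
have [|[c ac]|[c bc]] := pP a b; first by exists 1; rewrite mulr1.
- right; have /eqP : p * (1 - c * b) = 0 by rewrite mulrBr mulr1 {1}pab {1}ac; ring.
  rewrite mulf_eq0 (negbTE p0) subr_eq0 /= => /eqP E.
  by apply/unitrP; exists c; rewrite [b * c]mulrC -E.
- left; have /eqP : p * (1 - c * a) = 0 by rewrite mulrBr mulr1 {1}pab {1}bc; ring.
  rewrite mulf_eq0 (negbTE p0) subr_eq0 /= => /eqP E.
  by apply/unitrP; exists c; rewrite [a * c]mulrC -E.
Qed.

Lemma prime_associate p u : prime_elt p -> u \is a GRing.unit -> prime_elt (p * u).
Proof.
move=> [p0 pU pP] uU.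
have div_pu x : divides (p * u) x <-> divides p x.
  split=> [[c ->]|[c ->]]; first by exists (u * c); ring.
  by exists (u^-1 * c); rewrite -mulrA [u * _]mulrA mulrV // mul1r.
split; first by rewrite mulf_neq0 //; apply: contraTneq uU => ->; rewrite unitr0.
  by rewrite unitrM uU andbT.
by move=> a b /div_pu /pP [|] /div_pu; [left|right].
Qed.

Lemma irreducible_prime f : factorial_ring A -> irreducible_elt f -> prime_elt f.
Proof.
move=> fA [f0 fU fI]; have [u [s [uU sP fE]]] := fA f f0.
case: s sP fE => [|p s] sP fE; first by move: fU; rewrite fE big_nil mulr1 uU.
have pP : prime_elt p by apply: sP; rewrite inE eqxx.
move: fE; rewrite big_cons => fE.
have fE' : f = p * (u * \prod_(j <- s) j) by rewrite fE; ring.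
have [pU|vU] := fI _ _ fE'; last by rewrite fE'; apply: prime_associate.
by case: pP => _; rewrite pU.
Qed.

(** Each prime of [s] divides f h but not f, so it can be cancelled from h. This removes the
    denominators of pseudo-division and, later, the powers of a linear form. *)
Lemma cancel_primes (s : seq A) f g h :
  (forall p, p \in s -> prime_elt p /\ ~ divides p f) ->
  (\prod_(p <- s) p) * g = f * h -> divides f g.
Proof.
elim: s h => [|p s IH] h sP; first by rewrite big_nil mul1r => ->; exists h.
rewrite big_cons => E.
have [[p0 pU pP] pf] : prime_elt p /\ ~ divides p f by apply: sP; rewrite inE eqxx.
have [||[h' hE]] := pP f h; rewrite -?E; last 1 first.
- apply: (IH h') => [q qs|]; first by apply: sP; rewrite inE qs orbT.
  by apply: (mulfI p0); rewrite mulrA E hE; ring.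
- by rewrite -mulrA; apply: divides_mulr; exists 1; rewrite mulr1.
- by [].
Qed.

Lemma prime_divides_prod p (s : seq A) :
  prime_elt p -> divides p (\prod_(q <- s) q) -> exists2 q, q \in s & divides p q.
Proof.
move=> [p0 pU pP]; elim: s => [|q s IH].
  by rewrite big_nil => /divides_unit; rewrite unitr1 (negbTE pU) => /(_ isT).
rewrite big_cons => /pP[pq|/IH[r rs pr]]; first by exists q; rewrite // inE eqxx.
by exists r; rewrite // inE rs orbT.
Qed.

Lemma exists_prime_divisor a :
  factorial_ring A -> a != 0 -> a \isn't a GRing.unit ->
  exists2 p, prime_elt p & divides p a.
Proof.
move=> fA a0 aU; have [u [[|p s] [uU sP aE]]] := fA a a0.
  by move: aU; rewrite aE big_nil mulr1 uU.
exists p; first by apply: sP; rewrite inE eqxx.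
by rewrite aE big_cons; exists (u * \prod_(j <- s) j); ring.
Qed.

End Divisibility.

(** * Gauss's lemma: polynomials over a factorial domain *)

Section Gauss.
Variable A : idomainType.
Implicit Types (a c p : A) (f g h q r : {poly A}).

(** If p divides a product it divides the leading coefficient of one factor; subtracting that
    leading term changes the product by a multiple of p, and the total size drops. *)
Lemma prime_polyC p : prime_elt p -> prime_elt (p%:P).
Proof.
case=> p0 pU pP.
have smaller x : x != 0 -> divides p (lead_coef x) ->
    exists y x', x = p%:P * y + x' /\ (size x' < size x)%N.
  move=> x0 [c cE]; exists (c%:P * 'X^((size x).-1)), (x - (p * c)%:P * 'X^((size x).-1)).
  split; first by rewrite polyCM; ring.
  have sx : (0 < size x)%N by rewrite size_poly_gt0.
  rewrite -[X in (_ < X)%N](prednK sx) ltnS; apply/leq_sizeP => j.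
  rewrite leq_eqVlt => /orP[/eqP <-|lj].
    by rewrite coefB coefCM coefXn eqxx mulr1 -cE lead_coefE subrr.
  rewrite coefB coefCM coefXn gtn_eqF // mulr0 subr0 nth_default //.
  by move: lj; rewrite prednK.
split; rewrite ?polyC_eq0 //.
  by rewrite poly_unitE size_polyC p0 coefC eqxx /= pU.
move=> a b; have [n] := ubnP (size a + size b)%N.
elim: n a b => // n IH a b; rewrite ltnS => sab dab.
have [->|a0] := eqVneq a 0; first by left; exists 0; rewrite mulr0.
have [->|b0] := eqVneq b 0; first by right; exists 0; rewrite mulr0.
have : divides p (lead_coef a * lead_coef b).
  case: dab => c abE; exists (lead_coef c).
  by rewrite -lead_coefM abE lead_coefM lead_coefC.
case/pP=> [/(smaller _ a0)[y [x' [xE sx]]]|/(smaller _ b0)[y [x' [xE sx]]]].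
  have [||[z zE]|] := IH x' b; last by right.
  - by apply: leq_trans sab; rewrite ltn_add2r.
  - have -> : x' * b = a * b + - (p%:P * (y * b)) by rewrite {1}xE; ring.
    by apply: dividesD => //; exists (- (y * b)); ring.
  by left; rewrite xE zE; exists (y + z); ring.
have [|||[z zE]] := IH a x'; last by right; rewrite xE zE; exists (y + z); ring.
- by apply: leq_trans sab; rewrite ltn_add2l.
- have -> : a * x' = a * b + - (p%:P * (y * a)) by rewrite {1}xE; ring.
  by apply: dividesD => //; exists (- (y * a)); ring.
by left.
Qed.

Definition in_ideal2 (B : idomainType) (f g x : B) : Prop :=
  exists a b : B, x = a * f + b * g.

(** A nonzero element of least size in (f, g) serves as a gcd over the fraction field without
    forming that field; pseudo-division by it leaves no remainder. *)
Lemma min_size_ideal2 f g : f != 0 -> exists r, [/\ r != 0, in_ideal2 f g r &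
  forall x, in_ideal2 f g x -> x != 0 -> (size r <= size x)%N].
Proof.
move=> f0; have : exists2 x, in_ideal2 f g x & x != 0.
  by exists f => //; exists 1, 0; ring.
case=> x; have [n] := ubnP (size x); elim: n x => // n IH x; rewrite ltnS => sx xI x0.
have [[y [yI y0 sy]]|nex] :=
  classic (exists y, [/\ in_ideal2 f g y, y != 0 & (size y < size x)%N]).
  by apply: (IH y) => //; apply: leq_trans sx.
exists x; split=> // y yI y0; rewrite leqNgt; apply/negP => sy.
by apply: nex; exists y.
Qed.

Lemma min_size_pseudo_divides f g r x : r != 0 -> in_ideal2 f g r ->
  (forall y, in_ideal2 f g y -> y != 0 -> (size r <= size y)%N) ->
  in_ideal2 f g x -> exists c q, c != 0 /\ c%:P * x = r * q.
Proof.
move=> r0 [a [b rE]] rmin [a' [b' xE]].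
have E := Pdiv.Idomain.divp_eq x r.
set c := lead_coef r ^+ _ in E.
exists c, (x %/ r); split; first by rewrite expf_neq0 // lead_coef_eq0.
have modE : x %% r = c%:P * x - r * (x %/ r) by rewrite mul_polyC E; ring.
have [m0|m0] := eqVneq (x %% r) 0.
  by apply/eqP; rewrite -subr_eq0 -modE m0.
have := rmin _ _ m0; rewrite leqNgt Pdiv.Idomain.ltn_modp r0 => H; exfalso.
suff /H : in_ideal2 f g (x %% r) by [].
rewrite modE; exists (c%:P * a' - a * (x %/ r)), (c%:P * b' - b * (x %/ r)).
by rewrite xE {1}rE; ring.
Qed.

(** By [prime_polyC] each prime of the constant divides [r] or [q], and is moved out of that factor
    into [a] or [b]. *)
Lemma primitive_factor (s : seq A) f r q : (forall p, p \in s -> prime_elt p) ->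
  (\prod_(p <- s) p)%:P * f = r * q ->
  exists r' q' a b, [/\ f = r' * q', r = a%:P * r', q = b%:P * q'
    & a * b = \prod_(p <- s) p].
Proof.
elim: s r q => [|p s IH] r q sP.
  rewrite big_nil polyC1 mul1r => ->; exists r, q, 1, 1.
  by rewrite polyC1 !mul1r.
have pP : prime_elt p by apply: sP; rewrite inE eqxx.
have {}sP t : t \in s -> prime_elt t by move=> ts; apply: sP; rewrite inE ts orbT.
rewrite big_cons => E; have [p0 _ pD] := prime_polyC pP.
have [|[r1 rE]|[q1 qE]] := pD r q.
- by rewrite -E polyCM; exists ((\prod_(j <- s) j)%:P * f); ring.
- have [|r' [q' [a [b [-> r1E -> abE]]]]] := IH r1 q sP.
    by apply: (mulfI p0); rewrite mulrA -polyCM E rE; ring.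
  exists r', q', (p * a), b; split=> //; first by rewrite rE r1E polyCM; ring.
  by rewrite -abE; ring.
- have [|r' [q' [a [b [-> -> q1E abE]]]]] := IH r q1 sP.
    by apply: (mulfI p0); rewrite mulrA -polyCM E qE; ring.
  exists r', q', a, (p * b); split=> //; first by rewrite qE q1E polyCM; ring.
  by rewrite -abE; ring.
Qed.

Definition primitive f := forall p, prime_elt p -> ~ divides p%:P f.

Hypothesis fA : factorial_ring A.

Lemma primitive_cancel c f g h : primitive f -> c != 0 ->
  c%:P * g = f * h -> divides f g.
Proof.
move=> fprim c0 E; have [u [s [uU sP cE]]] := fA c0.
apply: (@cancel_primes _ [seq p%:P | p <- s] f g (u^-1%:P * h)).
  move=> p /mapP[q /sP qP ->]; split; first exact: prime_polyC.
  exact: fprim.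
rewrite big_map -rmorph_prod /= mulrCA -E cE polyCM !mulrA -polyCM mulVr //.
by rewrite polyC1 mul1r.
Qed.

(** Let r be the gcd of f and g up to constants; its primitive part r' divides the irreducible f. If
    r' is a unit, a constant lies in (f, g), and multiplying by h puts a constant multiple of h in
    (f). Otherwise r' is associate to f and divides g up to a constant. Constants cancel because f
    is primitive. *)
Lemma primitive_irreducible_prime f :
  irreducible_elt f -> primitive f -> prime_elt f.
Proof.
move=> [f0 fU fI] fprim; split=> // g h [w wE].
have [r [r0 rI rmin]] := min_size_ideal2 g f0.
have pdiv x := min_size_pseudo_divides (x := x) r0 rI rmin.
have [|c [q [c0 E]]] := pdiv f; first by exists 1, 0; ring.
have [u [s [uU sP cE]]] := fA c0.
have [|r' [q' [a [b [fE rE qE abE]]]]] := @primitive_factor s f r (u^-1%:P * q) sP.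
  rewrite mulrCA -E cE polyCM !mulrA -polyCM mulVr //.
  by rewrite polyC1 mul1r.
have a0 : a != 0 by apply: contraNneq r0 => a0; rewrite rE a0 mul0r.
have [r'U|q'U] := fI _ _ fE.
- right; case: rI => x [y]; rewrite rE => xyE.
  apply: (@primitive_cancel a f h (r'^-1 * (x * h + y * w)) fprim a0).
  have -> : a%:P * h = r'^-1 * ((a%:P * r') * h).
    by rewrite [a%:P * r']mulrC !mulrA mulVr // mul1r.
  by rewrite xyE; ring: wE.
- left; have [|c' [q2 [c'0 E2]]] := pdiv g; first by exists 0, 1; ring.
  have r'E : r' = f * q'^-1 by rewrite fE mulrK.
  apply: (@primitive_cancel c' f g (q'^-1 * a%:P * q2) fprim c'0).
  by rewrite E2 rE {1}r'E; ring.
Qed.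

(** Dividing f by a prime constant removes one prime from the factorization of its leading
    coefficient, so the process stops. *)
Lemma content_primitive f : f != 0 -> exists c f1, [/\ c != 0, f = c%:P * f1 & primitive f1].
Proof.
move=> f0; have lf0 : lead_coef f != 0 by rewrite lead_coef_eq0.
have [u [s [uU sP lE]]] := fA lf0.
have [n sn] := ubnP (size s).
elim: n => // n IH in f f0 lf0 u s uU sP lE sn *.
have [fprim|nprim] := classic (primitive f).
  by exists 1, f; rewrite oner_neq0 polyC1 mul1r.
have [p [pP [f1 fE]]] : exists p, prime_elt p /\ divides p%:P f.
  by apply: NNPP => nex; apply: nprim => p pP pf; apply: nex; exists p.
have p0 : p != 0 by case: pP.
have f10 : f1 != 0 by apply: contraNneq f0 => f10; rewrite fE f10 mulr0.
have lf1E : lead_coef f = p * lead_coef f1 by rewrite fE lead_coefM lead_coefC.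
have [q qs [v qE]] : exists2 q, q \in s & divides p q.
  apply: prime_divides_prod => //; exists (u^-1 * lead_coef f1).
  by rewrite mulrCA -lf1E lE mulrA mulVr ?mul1r.
have [_ _ qI] := prime_irreducible (sP q qs).
have vU : v \is a GRing.unit.
  by have [pU|//] := qI _ _ qE; case: pP => _; rewrite pU.
have [|||||c [f2 [c0 f1E f2P]]] := IH f1 f10 _ (u * v) (rem q s).
- by rewrite lead_coef_eq0.
- by rewrite unitrM uU.
- by move=> r /mem_rem /sP.
- apply: (mulfI p0); rewrite -lf1E lE (perm_big _ (perm_to_rem qs)) big_cons /=.
  by rewrite {1}qE; ring.
- by rewrite size_rem // -ltnS prednK //; case: (s) qs.
exists (p * c), f2; split=> //; first by rewrite mulf_neq0.
by rewrite fE f1E polyCM; ring.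
Qed.

Lemma primitive_mull f g : primitive (f * g) -> primitive f.
Proof. by move=> P p pP pf; apply: (P p pP); apply: divides_mulr. Qed.

Lemma primitive_const_unit f : f != 0 -> (size f <= 1)%N -> primitive f ->
  f \is a GRing.unit.
Proof.
move=> f0 sf fprim; have fE := size1_polyC sf.
have c0 : f`_0 != 0 by rewrite -polyC_eq0 -fE.
rewrite poly_unitE eqn_leq sf size_poly_gt0 f0 /=.
apply/negPn/negP => cU; have [p pP [c cE]] := exists_prime_divisor fA c0 cU.
by apply: (fprim p pP); exists c%:P; rewrite -polyCM -cE.
Qed.

(** A primitive polynomial is split until its factors are irreducible. The factors stay primitive,
    and a primitive constant is a unit, so each proper factor has smaller degree. *)
Lemma factorial_poly : factorial_ring {poly A}.
Proof.
have H g : g != 0 -> primitive g -> exists (u : {poly A}) (s : seq {poly A}), [/\ u \is a GRing.unit,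
    (forall f, f \in s -> prime_elt f) & g = u * \prod_(f <- s) f].
  have [n] := ubnP (size g); elim: n g => // n IH g sg g0 gprim.
  have [gU|gU] := boolP (g \is a GRing.unit).
    by exists g, [::]; split; rewrite ?big_nil ?mulr1.
  have [gI|gI] := classic (irreducible_elt g).
    exists 1, [:: g]; split; rewrite ?unitr1 ?big_seq1 ?mul1r // => p.
    by rewrite inE => /eqP ->; apply: primitive_irreducible_prime.
  have [a [b [gE aU bU]]] : exists a b : {poly A}, [/\ g = a * b, a \isn't a GRing.unit
      & b \isn't a GRing.unit].
    apply: NNPP => nex; apply: gI; split=> // a b gE.
    apply/orP/negPn/negP; rewrite negb_or => /andP[aU bU].
    by apply: nex; exists a, b.
  have a0 : a != 0 by apply: contraNneq g0 => a0; rewrite gE a0 mul0r.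
  have b0 : b != 0 by apply: contraNneq g0 => b0; rewrite gE b0 mulr0.
  have aprim : primitive a by apply: (@primitive_mull _ b); rewrite -gE.
  have bprim : primitive b by apply: (@primitive_mull _ a); rewrite mulrC -gE.
  have sa : (1 < size a)%N.
    by rewrite ltnNge; apply: contra aU => sa; apply: primitive_const_unit.
  have sb : (1 < size b)%N.
    by rewrite ltnNge; apply: contra bU => sb; apply: primitive_const_unit.
  have sE : size g = (size a + size b).-1 by rewrite gE size_mul.
  have [|u [s [uU sP aE]]] := IH a _ a0 aprim.
    by move: sg; rewrite ltnS sE; case: (size b) sb => [|[|m]] //=; rewrite !addnS /=; lia.
  have [|v [t [vU tP bE]]] := IH b _ b0 bprim.
    by move: sg; rewrite ltnS sE; case: (size a) sa => [|[|m]] //=; rewrite !addSn /=; lia.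
  exists (u * v), (s ++ t); split; first by rewrite unitrM uU.
    by move=> p; rewrite mem_cat => /orP[/sP|/tP].
  by rewrite gE aE bE big_cat /=; ring.
move=> f f0; have [c [f1 [c0 fE f1prim]]] := content_primitive f0.
have f10 : f1 != 0 by apply: contraNneq f0 => f10; rewrite fE f10 mulr0.
have [v [t [vU tP f1E]]] := H f1 f10 f1prim.
have [u [s [uU sP cE]]] := fA c0.
exists (u%:P * v), ([seq p%:P | p <- s] ++ t); split.
- by rewrite unitrM vU andbT; apply: rmorph_unit.
- move=> p; rewrite mem_cat => /orP[/mapP[q /sP qP ->]|/tP //].
  exact: prime_polyC.
- by rewrite fE f1E cE big_cat big_map polyCM rmorph_prod /=; ring.
Qed.

End Gauss.

Section Transport.
Variables (A B : idomainType) (phi : {rmorphism A -> B}) (psi : {rmorphism B -> A}).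
Hypotheses (phiK : cancel phi psi) (psiK : cancel psi phi).

Lemma prime_transport p : prime_elt p -> prime_elt (psi p).
Proof.
move=> [p0 pU pP]; split.
- by apply: contraNneq p0 => /(congr1 phi); rewrite psiK rmorph0 => ->.
- by apply: contra pU => /(rmorph_unit phi); rewrite psiK.
move=> a b [c abE]; have [|[d dE]|[d dE]] := pP (phi a) (phi b).
- by exists (phi c); rewrite -rmorphM abE rmorphM psiK.
- by left; exists (psi d); rewrite -rmorphM -dE phiK.
- by right; exists (psi d); rewrite -rmorphM -dE phiK.
Qed.

Lemma factorial_transport : factorial_ring B -> factorial_ring A.
Proof.
move=> fB a a0; have pa0 : phi a != 0.
  by apply: contraNneq a0 => /(congr1 psi); rewrite phiK rmorph0 => ->.
have [u [s [uU sP aE]]] := fB _ pa0.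
exists (psi u), [seq psi p | p <- s]; split; first exact: rmorph_unit.
  by move=> p /mapP[q /sP qP ->]; apply: prime_transport.
by rewrite big_map -rmorph_prod -rmorphM -aE phiK.
Qed.
End Transport.

(** The standard way below to compare evaluations and substitutions: it is enough to look at
    constants and variables. *)
Lemma mpoly_rmorph_ext (n : nat) (K : nzRingType) (B : comNzRingType)
    (phi psi : {rmorphism {mpoly K[n]} -> B}) :
  (forall c, phi c%:MP = psi c%:MP) -> (forall i, phi 'X_i = psi 'X_i) ->
  phi =1 psi.
Proof.
move=> EC EX p; rewrite [p]mpolyE !rmorph_sum; apply: eq_bigr => m _.
rewrite -mul_mpolyC !rmorphM EC mpolyXE_id !rmorph_prod; congr (_ * _).
by apply: eq_bigr => i _; rewrite !rmorphXn EX.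
Qed.

(** * Induction on the number of variables *)

Section MpolyFactorial.
Variable k : fieldType.

Section Muni.
Variable n : nat.

Lemma comm_mwiden : commr_rmorph (@mwiden n k) 'X_ord_max.
Proof. by move=> x; apply: mulrC. Qed.

Definition muni_inv : {poly {mpoly k[n]}} -> {mpoly k[n.+1]} :=
  horner_morph comm_mwiden.
HB.instance Definition _ := GRing.RMorphism.on muni_inv.

Lemma muniX_widen (i : 'I_n) : muni ('X_(widen_ord (leqnSn n) i) : {mpoly k[n.+1]}) = ('X_i)%:P.
Proof.
rewrite muniE msuppX big_seq1 mcoeffX eqxx scale1r mnm1E.
rewrite [_ == ord_max]negbTE ?expr0 ?alg_polyC; last first.
  by apply/eqP => /(congr1 val) /= E; have := ltn_ord i; rewrite E ltnn.
congr (_)%:P; congr ('X_[_]); apply/mnmP => j; rewrite mnmE !mnm1E.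
by rewrite -val_eqE.
Qed.

Lemma muniX_max : muni ('X_ord_max : {mpoly k[n.+1]}) = 'X.
Proof.
rewrite muniE msuppX big_seq1 mcoeffX eqxx scale1r mnm1E eqxx expr1.
rewrite [X in 'X_[X]](_ : _ = 0%MM) ?mpolyX0 ?scale1r //.
apply/mnmP => j; rewrite mnmE mnm1E mnm0E.
by apply/eqP; rewrite eqb0; apply/eqP => /(congr1 val) /= E; have := ltn_ord j; rewrite -E ltnn.
Qed.

Lemma muni_invD : {morph muni_inv : p q / p + q}.
Proof. exact: rmorphD. Qed.

Lemma muni_invM : {morph muni_inv : p q / p * q}.
Proof. exact: rmorphM. Qed.

Lemma muni_invC c : muni_inv c%:P = mwiden c.
Proof. exact: horner_morphC. Qed.

Lemma muni_invX : muni_inv 'X = 'X_ord_max.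
Proof. exact: horner_morphX. Qed.

Lemma muniK : cancel (@muni n k) muni_inv.
Proof.
apply: (@mpoly_rmorph_ext _ _ _ (muni_inv \o @muni n k) idfun) => [c|i] /=.
  by rewrite muniC muni_invC mwidenC.
have [->|i_max] := eqVneq i ord_max; first by rewrite muniX_max muni_invX.
have ltin : (i < n)%N.
  have := ltn_ord i; rewrite ltnS leq_eqVlt => /orP[/eqP E|//].
  by move: i_max; rewrite -val_eqE /= E eqxx.
have -> : i = widen_ord (leqnSn n) (Ordinal ltin) by apply: val_inj.
by rewrite muniX_widen muni_invC mwidenX mnmwiden1.
Qed.

Lemma muni_mwiden (c : {mpoly k[n]}) : muni (mwiden c) = c%:P.
Proof.
apply: (@mpoly_rmorph_ext _ _ _ (@muni n k \o @mwiden n k) (@polyC _)) => [a|i] /=.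
  by rewrite mwidenC muniC.
by rewrite mwidenX mnmwiden1 muniX_widen.
Qed.

Lemma muni_invK : cancel muni_inv (@muni n k).
Proof.
elim/poly_ind => [|p c IH]; first by rewrite rmorph0 muni0.
rewrite muni_invD muniD muni_invM muniM muni_invX muniX_max muni_invC muni_mwiden.
by rewrite IH.
Qed.
End Muni.

Lemma factorial_mpoly n : factorial_ring {mpoly k[n]}.
Proof.
elim: n => [|n IH]; last exact: factorial_transport (@muniK n) (@muni_invK n) (factorial_poly IH).
move=> p p0; exists p, [::]; split=> //; last by rewrite big_nil mulr1.
rewrite [p]nvar0_mpolyC; apply: rmorph_unit; rewrite unitfE.
by apply: contraNneq p0 => c0; rewrite [p]nvar0_mpolyC c0 mpolyC0.
Qed.

End MpolyFactorial.

(** * Polynomial maps, Euler's identity and homogeneous components *)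

Lemma mpoly_ring_ind (n : nat) (K : nzRingType) (P : {mpoly K[n]} -> Prop) :
  (forall c, P c%:MP) -> (forall i, P 'X_i) ->
  (forall p q, P p -> P q -> P (p + q)) -> (forall p q, P p -> P q -> P (p * q)) ->
  forall p, P p.
Proof.
move=> PC PX PD PM; have PXm m : P 'X_[m].
  rewrite mpolyXE_id; elim/big_ind: _ => // [|i _]; first by rewrite -mpolyC1.
  elim: (m i) => [|j IH]; first by rewrite expr0 -mpolyC1.
  by rewrite exprS; apply: PM.
elim/mpolyind => [|c m p _ _ Pp]; first by rewrite -mpolyC0.
by apply: PD => //; rewrite -mul_mpolyC; apply: PM.
Qed.

(** [D] is any derivation that kills the constants, so that one statement covers restrictions to
    lines and to parabolas. *)
Lemma chain_rule (n : nat) (K : nzRingType) (B : comNzRingType)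
    (phi : {rmorphism {mpoly K[n]} -> B}) (D : B -> B) :
  (forall a b, D (a + b) = D a + D b) ->
  (forall a b, D (a * b) = D a * b + a * D b) ->
  (forall c, D (phi c%:MP) = 0) ->
  forall p, D (phi p) = \sum_(i < n) phi p^`M(i) * D (phi 'X_i).
Proof.
move=> DD DM DC; elim/mpoly_ring_ind => [c|i|p q Ep Eq|p q Ep Eq].
- by rewrite DC big1 // => i _; rewrite mderivC rmorph0 mul0r.
- rewrite (bigD1 i) //= mderivX mnm1E eqxx scale1r.
  have -> : (U_(i) - U_(i) = 0)%MM by apply/mnmP => j; rewrite mnmBE subnn mnm0E.
  rewrite mpolyX0 rmorph1 mul1r.
  rewrite big1 ?addr0 // => j /negbTE ji.
  by rewrite mderivX mnm1E eq_sym ji scale0r rmorph0 mul0r.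
- rewrite rmorphD DD Ep Eq -big_split; apply: eq_bigr => i _ /=.
  by rewrite mderivD rmorphD mulrDl.
- rewrite rmorphM DM Ep Eq big_distrl big_distrr -big_split.
  apply: eq_bigr => i _ /=.
  by rewrite mderivM rmorphD !rmorphM; ring.
Qed.

(** * Polynomial identities tested at points *)

Section InfiniteField.
Variable k : fieldType.
Hypothesis char0 : [pchar k] =i pred0.

Lemma natr_inj_char0 : injective (fun i : nat => i%:R : k).
Proof.
have E := (pcharf0P k).1 char0.
move=> i j; wlog ij : i j / (i <= j)%N.
  by move=> H; case: (leqP i j) => [/H //|/ltnW /H H' /esym /H' ->].
move=> Eij; apply/eqP; rewrite eqn_leq ij -subn_eq0 -E natrB //.
by rewrite Eij subrr eqxx.
Qed.

(** The threshold allows the point 0 to be left out, as in a change of chart, and fits Hilbert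
    polynomials, which are known only for large arguments. *)
Lemma poly_nat_eq0 (p : {poly k}) (N : nat) :
  (forall i, (N <= i)%N -> p.[i%:R] = 0) -> p = 0.
Proof.
move=> H; apply: (@roots_geq_poly_eq0 _ p [seq i%:R | i <- iota N (size p)]).
- by apply/allP => x /mapP[i]; rewrite mem_iota => /andP[Ni _] ->; apply/eqP/H.
- by rewrite map_inj_uniq ?iota_uniq //; apply: natr_inj_char0.
- by rewrite size_map size_iota.
Qed.

Lemma poly_eval_eq0 (p : {poly k}) : (forall x, p.[x] = 0) -> p = 0.
Proof. by move=> H; apply: (@poly_nat_eq0 p 0) => i _. Qed.

Lemma meval_muni n (p : {mpoly k[n.+1]}) (v : 'I_n.+1 -> k) :
  p.@[v] = (map_poly (meval (v \o widen_ord (leqnSn n))) (muni p)).[v ord_max].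
Proof.
pose g := horner_eval (v ord_max) \o map_poly (meval (v \o widen_ord (leqnSn n))) \o @muni n k.
apply: (@mpoly_rmorph_ext n.+1 k k (meval v) g) => [c|i].
  by rewrite /g /= mevalC muniC map_polyC /= mevalC /horner_eval hornerC.
rewrite /g /= /horner_eval mevalXU.
have [->|i_max] := eqVneq i ord_max; first by rewrite muniX_max map_polyX hornerX.
have ltin : (i < n)%N.
  have := ltn_ord i; rewrite ltnS leq_eqVlt => /orP[/eqP E|//].
  by move: i_max; rewrite -val_eqE /= E eqxx.
have -> : i = widen_ord (leqnSn n) (Ordinal ltin) by apply: val_inj.
by rewrite muniX_widen map_polyC /= mevalXU hornerC.
Qed.

Lemma meval_eq0 n (p : {mpoly k[n]}) : (forall v, p.@[v] = 0) -> p = 0.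
Proof.
elim: n p => [|n IH] p H.
  by have := H (fun _ => 0); rewrite [p]nvar0_mpolyC mevalC => ->; rewrite mpolyC0.
rewrite -[p]muniK; suff -> : muni p = 0 by rewrite rmorph0.
apply/polyP => j; rewrite coef0; apply: IH => w.
pose v t (i : 'I_n.+1) := if unlift ord_max i is Some i' then w i' else t.
have vw t : v t \o widen_ord (leqnSn n) =1 w.
  move=> i; rewrite /v /=.
  have -> : widen_ord (leqnSn n) i = lift ord_max i.
    by apply: val_inj; rewrite /= /bump leqNgt ltn_ord.
  by rewrite liftK.
have : map_poly (meval w) (muni p) = 0.
  apply: poly_eval_eq0 => t; rewrite -[RHS](H (v t)) meval_muni /=.
  rewrite {2}/v unlift_none; congr (_.[t]).
  by apply: eq_map_poly => q; apply: meval_eq => i; rewrite vw.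
by move/(congr1 (fun q : {poly k} => q`_j)); rewrite coef_map coef0.
Qed.

End InfiniteField.

Section Homogeneous.
Variables (n : nat) (k : fieldType).
Implicit Types p q : {mpoly k[n]}.

Lemma msize_homog d p : p != 0 -> p \is d.-homog -> msize p = d.+1.
Proof.
move=> p0 /dhomogP pd; rewrite -(mlead_deg p0); congr _.+1.
exact: pd (mlead_supp p0).
Qed.

Lemma meval_scale_homog d p (c : k) (v : 'I_n -> k) :
  p \is d.-homog -> p.@[fun i => c * v i] = c ^+ d * p.@[v].
Proof.
move=> /dhomogP pd; rewrite !mevalE big_distrr /= big_seq [RHS]big_seq.
apply: eq_bigr => m /pd md; rewrite mulrCA; congr (_ * _).
under eq_bigr => i _ do rewrite exprMn.
rewrite big_split /= prodrXr; congr (_ ^+ _ * _).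
by rewrite -mdegE; exact: md.
Qed.

Lemma euler_identity d p : p \is d.-homog ->
  \sum_(i < n) 'X_i * p^`M(i) = d%:R *: p.
Proof.
move=> /dhomogP pd.
transitivity (\sum_(m <- msupp p) p@_m *: \sum_(i < n) 'X_i * ('X_[k, m])^`M(i)).
  under [RHS]eq_bigr => m _ do rewrite scaler_sumr.
  rewrite exchange_big /=; apply: eq_bigr => i _.
  rewrite {1}[p]mpolyE linear_sum mulr_sumr; apply: eq_bigr => m _.
  by rewrite linearZ scalerAr.
rewrite {3}[p]mpolyE scaler_sumr big_seq [RHS]big_seq; apply: eq_bigr => m /pd md.
rewrite scalerA mulrC -scalerA; congr (_ *: _).
have {}md : mdeg m = d := md.
rewrite -md mdegE natr_sum scaler_suml; apply: eq_bigr => i _.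
rewrite mderivX -scalerAr -mpolyXD addmC.
have [->|mi] := eqVneq (m i) 0; first by rewrite !scale0r.
by rewrite submK // lep1mP.
Qed.

Lemma mderiv_homog d p i : p \is d.+1.-homog -> p^`M(i) \is d.-homog.
Proof.
move=> /dhomogP pd; apply/dhomogP => m; rewrite mcoeff_msupp mcoeff_deriv => H.
have : (m + U_(i))%MM \in msupp p.
  by rewrite mcoeff_msupp; apply: contraNneq H => ->; rewrite mul0rn.
move/pd => E; have {E} : mdeg (m + U_(i))%MM = d.+1 := E.
by rewrite mdegD mdeg1 addn1 => -[].
Qed.

Lemma pihomogMl e j p q : p \is e.-homog ->
  pihomog mdeg (e + j) (p * q) = p * pihomog mdeg j q.
Proof.
move=> pe; rewrite {1}(pihomog_partitionE (leqnn (msize q))).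
rewrite mulr_sumr linear_sum /=.
have [jq|qj] := ltnP j (msize q); last first.
  have -> : pihomog mdeg j q = 0.
    rewrite pihomogE big_seq_cond big_pred0 // => m.
    apply/negbTE/negP => /andP[/msize_mdeg_lt mq /eqP mj].
    by move: mq; rewrite [mdeg m]mj ltnNge qj.
  rewrite mulr0; apply: big1 => i _; apply: (@pihomog_ne0 _ _ _ (e + i)).
    by rewrite eqn_add2l neq_ltn (leq_trans (ltn_ord i) qj).
  exact: dhomogM pe (pihomogP _ _ _).
rewrite (bigD1 (Ordinal jq)) //= pihomog_dE; last exact: dhomogM pe (pihomogP _ _ _).
rewrite big1 ?addr0 // => i ij; apply: (@pihomog_ne0 _ _ _ (e + i)); last first.
  exact: dhomogM pe (pihomogP _ _ _).
by rewrite eqn_add2l -val_eqE in ij *.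
Qed.

Lemma pihomogM_low e j p q : p \is e.-homog -> (j < e)%N ->
  pihomog mdeg j (p * q) = 0.
Proof.
move=> pe je; rewrite (pihomog_partitionE (leqnn (msize q))) mulr_sumr linear_sum.
apply: big1 => i _; apply: (@pihomog_ne0 _ _ _ (e + i)).
  by rewrite neq_ltn (leq_trans je) ?orbT ?leq_addr.
exact: dhomogM pe (pihomogP _ _ _).
Qed.

Lemma mcoeff_pihomog d p m :
  (pihomog mdeg d p)@_m = if mdeg m == d then p@_m else 0.
Proof.
rewrite pihomogE raddf_sum /= big_mkcond /=.
have [mp|mp] := boolP (m \in msupp p); last first.
  rewrite (memN_msupp_eq0 mp) if_same big_seq big1 // => m' m'p.
  case: ifP => // _; rewrite mcoeffZ mcoeffX.
  have [mm|_] := eqVneq m' m; last by rewrite mulr0.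
  by move: mp; rewrite -mm m'p.
rewrite (bigD1_seq m) //= big1 ?addr0 => [|m' /negbTE mm].
  by case: ifP => // _; rewrite mcoeffZ mcoeffX eqxx mulr1.
by case: ifP => // _; rewrite mcoeffZ mcoeffX mm mulr0.
Qed.

Lemma pihomog0E p : pihomog mdeg 0 p = (p@_0%MM)%:MP.
Proof.
apply/mpolyP => m; rewrite mcoeff_pihomog mcoeffC mdeg_eq0.
by have [->|_] := eqVneq; rewrite ?mulr1 ?mulr0.
Qed.

(** As q starts in degree e, only the constant term of p contributes. This reads off the lowest part
    of a combination of basis syzygies. *)
Lemma pihomogM_lowest e p q : (forall j, (j < e)%N -> pihomog mdeg j q = 0) ->
  pihomog mdeg e (p * q) = p@_0%MM *: pihomog mdeg e q.
Proof.
move=> qe; rewrite [p in LHS](pihomog_partitionE (leqnSn (msize p))).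
rewrite mulr_suml linear_sum /= big_ord_recl /= big1 ?addr0.
  rewrite -[X in pihomog mdeg X (_ * q)]add0n pihomogMl; last exact: pihomogP.
  by rewrite pihomog0E mul_mpolyC.
move=> i _; have [ie|ei] := leqP (bump 0 i) e.
  rewrite -(subnKC ie) pihomogMl; last exact: pihomogP.
  by rewrite qe ?mulr0 // ltn_subrL; case: e {qe} ie.
by apply: pihomogM_low ei; apply: pihomogP.
Qed.

End Homogeneous.

Lemma homog1_prime (k : fieldType) (n : nat) (l : {mpoly k[n]}) : l != 0 -> l \is 1.-homog -> prime_elt l.
Proof.
move=> l0 lh; apply: irreducible_prime; first exact: factorial_mpoly.
have sl := msize_homog l0 lh.
split=> // [|a b ab].
  by apply/negP => /andP[/eqP E _]; move: sl; rewrite E msizeC; case: eqP.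
have a0 : a != 0 by apply: contraNneq l0 => a0; rewrite ab a0 mul0r.
have b0 : b != 0 by apply: contraNneq l0 => b0; rewrite ab b0 mulr0.
move: sl; rewrite ab msizeM // => E.
have unit1 (h : {mpoly k[n]}) : h != 0 -> (msize h <= 1)%N -> h \is a GRing.unit.
  move=> h0 /msize1_polyC hE; rewrite hE; apply: rmorph_unit; rewrite unitfE.
  by apply: contraNneq h0 => c0; rewrite hE c0 mpolyC0.
have [sa|sa] := leqP (msize a) 1; first by left; apply: unit1.
right; apply: unit1 => //; move: E sa; move: (mmeasure _ a) (mmeasure _ b) => i j.
by clear; lia.
Qed.

(** * Syzygies of the gradient *)

Local Notation o0 := (@Ordinal 3 0 isT).
Local Notation o1 := (@Ordinal 3 1 isT).
Local Notation o2 := (@Ordinal 3 2 isT).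

Lemma forall_ord3 (P : 'I_3 -> Prop) : P o0 -> P o1 -> P o2 -> forall i, P i.
Proof.
by move=> P0 P1 P2 [[|[|[|//]]] lt3]; [move: P0|move: P1|move: P2];
  congr P; apply: val_inj.
Qed.

Lemma sum_ord3 (V : nmodType) (F : 'I_3 -> V) :
  \sum_(i < 3) F i = F o0 + F o1 + F o2.
Proof.
rewrite !big_ord_recr big_ord0 /= add0r.
by congr (_ + _ + _); congr F; apply: val_inj.
Qed.

(** * Cross products, determinants and Koszul syzygies in rank three *)

Section Cross.
Variable B : comNzRingType.
Implicit Types s t u F : 'rV[B]_3.

Definition row3 (a b c : B) : 'rV[B]_3 :=
  \row_i (if i == o0 then a else if i == o1 then b else c).

Lemma row3_0 a b c : row3 a b c 0 o0 = a. Proof. by rewrite mxE. Qed.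
Lemma row3_1 a b c : row3 a b c 0 o1 = b. Proof. by rewrite mxE. Qed.
Lemma row3_2 a b c : row3 a b c 0 o2 = c. Proof. by rewrite mxE. Qed.
Definition row3E := (row3_0, row3_1, row3_2).

Lemma rowP3 s t : s 0 o0 = t 0 o0 -> s 0 o1 = t 0 o1 -> s 0 o2 = t 0 o2 -> s = t.
Proof. by move=> E0 E1 E2; apply/rowP; apply: forall_ord3. Qed.

Definition cross s t : 'rV[B]_3 :=
  row3 (s 0 o1 * t 0 o2 - s 0 o2 * t 0 o1) (s 0 o2 * t 0 o0 - s 0 o0 * t 0 o2)
       (s 0 o0 * t 0 o1 - s 0 o1 * t 0 o0).

Definition dot s t : B := \sum_(i < 3) s 0 i * t 0 i.

Lemma dotE s t : dot s t = s 0 o0 * t 0 o0 + s 0 o1 * t 0 o1 + s 0 o2 * t 0 o2.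
Proof. exact: sum_ord3. Qed.

Lemma cross_lin_comb (a b c d : B) s t :
  cross (a *: s + b *: t) (c *: s + d *: t) = (a * d - b * c) *: cross s t.
Proof. by apply: rowP3; rewrite !(row3E, mxE) /=; ring. Qed.

Lemma cross_scale (a b : B) s : cross (a *: s) (b *: s) = 0.
Proof. by apply: rowP3; rewrite !(row3E, mxE) /=; ring. Qed.

Lemma crossC s t : cross s t = - cross t s.
Proof. by apply: rowP3; rewrite !(row3E, mxE) /=; ring. Qed.

Lemma cross0r s : cross s 0 = 0.
Proof. by apply: rowP3; rewrite !(row3E, mxE) /=; ring. Qed.

(** This is (s x t) x F = (s.F) t - (t.F) s read coordinatewise, so it needs no division. *)
Lemma cross_colinear_normal s t F : dot s F = 0 -> dot t F = 0 ->
  forall i j, cross s t 0 i * F 0 j = cross s t 0 j * F 0 i.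
Proof.
rewrite !dotE => sF tF.
have E0 : cross s t 0 o0 * F 0 o1 = cross s t 0 o1 * F 0 o0.
  apply/eqP; rewrite -subr_eq0 !row3E; apply/eqP.
  transitivity (t 0 o2 * (s 0 o0 * F 0 o0 + s 0 o1 * F 0 o1 + s 0 o2 * F 0 o2)
    - s 0 o2 * (t 0 o0 * F 0 o0 + t 0 o1 * F 0 o1 + t 0 o2 * F 0 o2)); first ring.
  by rewrite sF tF; ring.
have E1 : cross s t 0 o1 * F 0 o2 = cross s t 0 o2 * F 0 o1.
  apply/eqP; rewrite -subr_eq0 !row3E; apply/eqP.
  transitivity (t 0 o0 * (s 0 o0 * F 0 o0 + s 0 o1 * F 0 o1 + s 0 o2 * F 0 o2)
    - s 0 o0 * (t 0 o0 * F 0 o0 + t 0 o1 * F 0 o1 + t 0 o2 * F 0 o2)); first ring.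
  by rewrite sF tF; ring.
have E2 : cross s t 0 o2 * F 0 o0 = cross s t 0 o0 * F 0 o2.
  apply/eqP; rewrite -subr_eq0 !row3E; apply/eqP.
  transitivity (t 0 o1 * (s 0 o0 * F 0 o0 + s 0 o1 * F 0 o1 + s 0 o2 * F 0 o2)
    - s 0 o1 * (t 0 o0 * F 0 o0 + t 0 o1 * F 0 o1 + t 0 o2 * F 0 o2)); first ring.
  by rewrite sF tF; ring.
by apply: forall_ord3; apply: forall_ord3.
Qed.

Lemma cross_eq0_colinear s t : cross s t = 0 ->
  forall x y, t 0 x * s 0 y = s 0 x * t 0 y.
Proof.
move=> st0.
have st l : cross s t 0 l = 0 by rewrite st0 mxE.
have := st o2; have := st o1; have := st o0; rewrite !row3E.
move=> /eqP; rewrite subr_eq0 => /eqP E0 /eqP; rewrite subr_eq0 => /eqP E1.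
move=> /eqP; rewrite subr_eq0 => /eqP E2.
apply: forall_ord3; apply: forall_ord3; rewrite 1?[LHS]mulrC //.
Qed.

Definition det3 s t u : B := dot s (cross t u).

(** Cramer's rule with denominators cleared: any four vectors of B^3 satisfy this relation. *)
Lemma det3_relation s t u (y : 'rV[B]_3) :
  det3 y t u *: s - det3 y s u *: t + det3 y s t *: u = det3 s t u *: y.
Proof.
by apply: rowP3; rewrite !mxE /det3 !dotE !row3E; ring.
Qed.

Lemma det3_normal s t u F : dot s F = 0 -> dot t F = 0 -> dot u F = 0 ->
  forall i, det3 s t u * F 0 i = 0.
Proof.
move=> sF tF uF i; rewrite /det3 dotE !mulrDl -!mulrA.
rewrite !(cross_colinear_normal tF uF _ i) !mulrA.
transitivity (dot s F * cross t u 0 i); first by rewrite dotE; ring.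
by rewrite sF mul0r.
Qed.

Definition koszul (F : 'rV[B]_3) (i : 'I_3) := cross (delta_mx 0 i) F.

Lemma koszul_dot F i : dot (koszul F i) F = 0.
Proof. by rewrite dotE !row3E; ring. Qed.

Lemma cross_koszul F : [/\ cross (koszul F o1) (koszul F o2) = F 0 o0 *: F,
  cross (koszul F o2) (koszul F o0) = F 0 o1 *: F
  & cross (koszul F o0) (koszul F o1) = F 0 o2 *: F].
Proof. by split; apply: rowP3; rewrite !(row3E, mxE) /=; ring. Qed.

End Cross.

Lemma sum_if3 (I : finType) (B : pzRingType) (V : lmodType B) (v : I -> V)
    (i j l : I) (a b c : B) : i != j -> i != l -> j != l ->
  \sum_x (if x == i then a else if x == j then b else if x == l then c else 0) *: v x
  = a *: v i + b *: v j + c *: v l.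
Proof.
move=> ij il jl; rewrite (bigD1 i) //= eqxx (bigD1 j) /=; last by rewrite eq_sym.
rewrite (bigD1 l) /=; last by rewrite eq_sym il eq_sym.
rewrite (negbTE (contra_neq (@esym _ _ _) ij)) eqxx.
rewrite (negbTE (contra_neq (@esym _ _ _) il)) (negbTE (contra_neq (@esym _ _ _) jl)) eqxx.
rewrite big1 ?addr0 ?addrA // => x /andP[/andP[/negbTE -> /negbTE ->] /negbTE ->].
by rewrite scale0r.
Qed.

Lemma sum_if2 (I : finType) (B : pzRingType) (V : lmodType B) (v : I -> V)
    (i j : I) (a b : B) : i != j ->
  \sum_x (if x == i then a else if x == j then b else 0) *: v x
  = a *: v i + b *: v j.
Proof.
move=> ij; rewrite (bigD1 i) //= eqxx (bigD1 j) /=; last by rewrite eq_sym.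
rewrite (negbTE (contra_neq (@esym _ _ _) ij)) eqxx.
rewrite big1 ?addr0 ?addrA // => x /andP[/negbTE -> /negbTE ->].
by rewrite scale0r.
Qed.

(* A free module orthogonal to F <> 0 has rank 2: three elements are dependent
   by the four-vector identity, and the Koszul relations need two. *)
Section FreeRank.
Variables (B : idomainType) (F : 'rV[B]_3).
Hypothesis F0 : F != 0.

Lemma exists_coord_neq0 : exists i, F 0 i != 0.
Proof.
apply: NNPP => H; case/eqP: F0; apply/rowP => i; rewrite mxE.
by apply/eqP/negPn/negP => Fi; apply: H; exists i.
Qed.

Lemma det3_eq0 s t u : dot s F = 0 -> dot t F = 0 -> dot u F = 0 -> det3 s t u = 0.
Proof.
move=> sF tF uF; have [i Fi] := exists_coord_neq0.
by have /eqP := det3_normal sF tF uF i; rewrite mulf_eq0 (negbTE Fi) orbF => /eqP.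
Qed.

(** A vanishing cross product gives the relations (b_j)_l b_i = (b_i)_l b_j, whose coefficients must
    vanish; then b_j = 0, which is a relation too. *)
Lemma independent_cross_neq0 (I : finType) (b : I -> 'rV[B]_3) (i j : I) : i != j ->
  (forall c, \sum_x c x *: b x = 0 -> forall x, c x = 0) ->
  cross (b i) (b j) != 0.
Proof.
move=> ij bfree; apply/eqP => E.
have bj l : b j 0 l = 0.
  have := bfree (fun x => if x == i then b j 0 l else if x == j then - b i 0 l else 0).
  move=> /(_ _ i); rewrite eqxx; apply; rewrite sum_if2 //.
  apply/rowP => y; rewrite !mxE mulNr; apply/eqP; rewrite subr_eq0; apply/eqP.
  exact: cross_eq0_colinear.
have := bfree (fun x => if x == i then 0 else if x == j then 1 else 0).
move=> /(_ _ j); rewrite sum_if2 // scale0r add0r scale1r.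
rewrite (negbTE (contra_neq (@esym _ _ _) ij)) eqxx => H.
have Hb : b j = 0 by apply/rowP => l; rewrite bj mxE.
by have /eqP := H Hb; rewrite oner_eq0.
Qed.
End FreeRank.

(** * Bases of a free syzygy module *)

Section FreeDivisor.
Variable k : fieldType.
Hypothesis char0 : [pchar k] =i pred0.
Local Notation R := {mpoly k[3]}.
Implicit Types (f : R) (s t : 'rV[R]_3).

Definition grad f : 'rV[R]_3 := \row_i f^`M(i).

Lemma gradE f i : grad f 0 i = f^`M(i).
Proof. by rewrite mxE. Qed.

Lemma syzP f s : reflect (dot s (grad f) = 0) (s \in syz f).
Proof.
rewrite inE /dot; under [X in reflect (X = 0)]eq_bigr => i _ do rewrite gradE.
exact: eqP.
Qed.

Lemma natr_neq0 n : n.+1%:R != 0 :> k.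
Proof. by rewrite (pcharf0P k).1. Qed.

Lemma grad_neq0 f d : f != 0 -> f \is d.+1.-homog -> grad f != 0.
Proof.
move=> f0 fh; apply: contraNneq f0 => g0.
have := euler_identity fh; rewrite big1 => [/esym/eqP|i _].
  by rewrite scaler_eq0 (negbTE (natr_neq0 d)).
by rewrite -gradE g0 mxE mulr0.
Qed.

Definition euler_field : 'rV[R]_3 := \row_i 'X_i.

Lemma dot_euler_field f d : f \is d.-homog -> dot euler_field (grad f) = d%:R *: f.
Proof.
move=> /euler_identity <-; rewrite /dot; apply: eq_bigr => i _.
by rewrite gradE mxE.
Qed.

Lemma free_syz_basis2 f d : f != 0 -> f \is d.+1.-homog -> free_divisor f ->
  exists b1 b2, [/\ b1 \in syz f, b2 \in syz f
    & forall s, s \in syz f -> exists a1 a2, s = a1 *: b1 + a2 *: b2].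
Proof.
move=> f0 fh [r [b [bS bspan bfree]]].
have F0 := grad_neq0 f0 fh.
have dotS s : s \in syz f -> dot s (grad f) = 0 by move/syzP.
have KS i : koszul (grad f) i \in syz f by apply/syzP; apply: koszul_dot.
(* Rank at most 1 would make the Koszul syzygies parallel, but their cross products are the F_i
   F. *)
have rank1 : ~ exists v, forall i, exists c, koszul (grad f) i = c *: v.
  move=> [v H]; have cr i j : cross (koszul (grad f) i) (koszul (grad f) j) = 0.
    have [ci ->] := H i; have [cj ->] := H j.
    exact: cross_scale.
  have [K12 K20 K01] := cross_koszul (grad f).
  have [i Fi] := exists_coord_neq0 F0; case/eqP: F0.
  have sc a : a *: grad f = 0 -> a != 0 -> grad f = 0.
    move=> E a0; apply/rowP => j; have := congr1 (fun v : 'rV_3 => v 0 j) E.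
    by rewrite !mxE => /eqP; rewrite mulf_eq0 (negbTE a0) => /eqP.
  move: i Fi; apply: forall_ord3 => Fi; apply: sc Fi;
    by rewrite -?K12 -?K20 -?K01 cr.
case: r b bS bspan bfree => [|[|[|r]]] b bS bspan bfree.
- case: rank1; exists 0 => i; have [c ->] := bspan _ (KS i).
  by exists 0; rewrite big_ord0 scale0r.
- case: rank1; exists (b ord0) => i; have [c ->] := bspan _ (KS i).
  by exists (c ord0); rewrite big_ord1.
- exists (b ord0), (b (lift ord0 ord0)); split=> // s /bspan[c ->].
  by exists (c ord0), (c (lift ord0 ord0)); rewrite big_ord_recl big_ord1.
exfalso; pose i0 : 'I_r.+3 := @Ordinal r.+3 0 isT.
pose i1 : 'I_r.+3 := @Ordinal r.+3 1 isT; pose i2 : 'I_r.+3 := @Ordinal r.+3 2 isT.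
(* With [y] a unit vector, the coefficient of [b i0] in the four-vector relation is a coordinate of
   [cross (b i1) (b i2)]; the term in [y] drops out since three syzygies have determinant 0. *)
have cr0 : cross (b i1) (b i2) = 0.
  apply/rowP => l; rewrite [RHS]mxE.
  pose y : 'rV[R]_3 := delta_mx 0 l.
  have rel := det3_relation (b i0) (b i1) (b i2) y.
  have D0 := det3_eq0 F0 (dotS _ (bS i0)) (dotS _ (bS i1)) (dotS _ (bS i2)).
  rewrite D0 scale0r in rel.
  have := bfree (fun x => if x == i0 then det3 y (b i1) (b i2) else
    if x == i1 then - det3 y (b i0) (b i2) else
    if x == i2 then det3 y (b i0) (b i1) else 0).
  rewrite sum_if3 // scaleNr => /(_ rel i0) E.
  have {E} : det3 y (b i1) (b i2) = 0 := E.
  rewrite /det3 /dot (bigD1 l) //= mxE !eqxx mul1r big1 ?addr0 // => j /negbTE jl.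
  by rewrite mxE jl andbF mul0r.
by have := independent_cross_neq0 (isT : i1 != i2) bfree; rewrite cr0 eqxx.
Qed.

(** Each f_i grad f is a cross product of Koszul syzygies, hence D_i w with w = b1 x b2. Summing
    with weights x_i gives D w = (d+1) f grad f by Euler's identity, and pairing with the Euler
    field gives D W = ((d+1) f)^2. Primality then decides which of D and W absorbs f. *)
Lemma free_syz_cross f d : prime_elt f -> f \is d.+1.-homog -> free_divisor f ->
  exists b1 b2, [/\ b1 \in syz f, b2 \in syz f,
    forall s, s \in syz f -> exists a1 a2, s = a1 *: b1 + a2 *: b2
    & exists2 c : k, c != 0 & cross b1 b2 = c%:MP *: grad f].
Proof.
move=> fP fh ffree; have [f0 fU fD] := fP.
have [b1 [b2 [b1S b2S bspan]]] := free_syz_basis2 f0 fh ffree.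
exists b1, b2; split=> //.
have KS i : koszul (grad f) i \in syz f by apply/syzP; apply: koszul_dot.
have [K12 K20 K01] := cross_koszul (grad f).
set w := cross b1 b2.
have Dw i : exists D, D *: w = grad f 0 i *: grad f.
  have cK x y : exists D, cross (koszul (grad f) x) (koszul (grad f) y) = D *: w.
    have [a1 [a2 ->]] := bspan _ (KS x); have [c1 [c2 ->]] := bspan _ (KS y).
    by exists (a1 * c2 - a2 * c1); exact: cross_lin_comb.
  move: i; apply: forall_ord3.
  - by have [D E] := cK o1 o2; exists D; apply: etrans K12.
  - by have [D E] := cK o2 o0; exists D; apply: etrans K20.
  - by have [D E] := cK o0 o1; exists D; apply: etrans K01.
have [D0 D0E] := Dw o0; have [D1 D1E] := Dw o1; have [D2 D2E] := Dw o2.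
clearbody w.
set D := 'X_o0 * D0 + 'X_o1 * D1 + 'X_o2 * D2.
have eul : dot euler_field (grad f) = d.+1%:R%:MP * f.
  by rewrite (dot_euler_field fh) mul_mpolyC.
have DE : D *: w = (d.+1%:R%:MP * f) *: grad f.
  rewrite -eul dotE !mxE /D !scalerDl -!scalerA D0E D1E D2E.
  by rewrite !gradE.
clearbody D.
have [v uv] : exists v, d.+1%:R%:MP * v = 1 :> R.
  by exists (d.+1%:R^-1%:MP); rewrite -mpolyCM mulfV ?natr_neq0.
set u : R := d.+1%:R%:MP in uv eul DE *.
have uE : u = d.+1%:R%:MP by [].
clearbody u.
set W := dot euler_field w.
have DWE : D * W = (u * f) * (u * f).
  rewrite -{2}eul /W !dotE !mulrDr; congr (_ + _ + _).
  - by have := congr1 (fun v : 'rV_3 => v 0 o0) DE; rewrite !mxE => E; ring: E.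
  - by have := congr1 (fun v : 'rV_3 => v 0 o1) DE; rewrite !mxE => E; ring: E.
  - by have := congr1 (fun v : 'rV_3 => v 0 o2) DE; rewrite !mxE => E; ring: E.
have WU : W \isn't a GRing.unit.
  have z i (p : R) : ('X_i * p)@_0%MM = 0.
    by rewrite (rmorphM (mcoeff 0%MM)) /= mcoeffX mnm1_eq0 mul0r.
  have W0 : W@_0%MM = 0 by rewrite /W dotE !mxE !mcoeffD !z !addr0.
  by apply/negP => /(rmorph_unit (mcoeff (0%MM : 'X_{1..3}))) /=; rewrite W0 unitr0.
have irr := prime_irreducible fP; have [_ _ fI] := irr.
(* If D = f D', then D' w = (d+1) grad f and f is D' W up to a constant. [W] is not a unit, so
   irreducibility makes D' a nonzero constant. *)
have caseD : divides f D -> exists2 c : k, c != 0 & w = c%:MP *: grad f.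
  move=> [D' D'E].
  have D'w : D' *: w = u *: grad f.
    apply/rowP => i; have := congr1 (fun v : 'rV_3 => v 0 i) DE.
    rewrite D'E; move: (w) (grad f) => w' F; rewrite !mxE => E.
    apply: (mulfI f0); rewrite mulrA E; ring.
  have D'W : f = (D' * v * v) * W.
    apply: (mulfI f0); transitivity ((D * W) * v * v); last by rewrite D'E; ring.
    by rewrite DWE; ring: uv.
  have [|U] := fI _ _ D'W; last by rewrite U in WU.
  rewrite -mulrA unitrM => /andP[U _].
  move: U; rewrite /GRing.unit /= => /andP[/eqP D'C D'U].
  exists (d.+1%:R / D'@_0); first by rewrite mulf_neq0 ?natr_neq0 // invr_neq0 // -unitfE.
  rewrite mpolyCM -uE mulrC -scalerA -D'w {2}D'C scalerA -mpolyCM mulVf ?scale1r //.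
  by rewrite -unitfE.
have fDW : divides f (D * W) by rewrite DWE; exists (u * (u * f)); ring.
have [/caseD //|[W' W'E]] := fD _ _ fDW.
have DW' : f = (D * v * v) * W'.
  apply: (mulfI f0); transitivity ((D * W) * v * v); last by rewrite W'E; ring.
  by rewrite DWE; ring: uv.
have [|W'U] := fI _ _ DW'; last first.
  apply: caseD; exists (W'^-1 * u * u); rewrite {1}DW'.
  transitivity (D * (W' * W'^-1) * (u * v) * (u * v)); last by ring.
  by rewrite mulrV // uv !mulr1.
(* Here [D] is a unit, so D_j w_j = f_j^2 and D w = (d+1) f grad f make f divide a nonzero partial
   derivative, whose degree is smaller. *)
rewrite -mulrA unitrM => /andP[DU _].
have [j Fj] := exists_coord_neq0 (grad_neq0 f0 fh).
have [Dj DjE] := Dw j.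
have fFj : grad f 0 j = f * (Dj * D^-1 * u).
  apply: (mulfI Fj).
  have := congr1 (fun v : 'rV_3 => v 0 j) DjE; rewrite mxE [RHS]mxE => <-.
  have := congr1 (fun v : 'rV_3 => v 0 j) DE; rewrite mxE [RHS]mxE => E.
  transitivity (Dj * D^-1 * (D * w 0 j)); last by rewrite E; ring.
  by rewrite -mulrA [D^-1 * _]mulrA mulVr // mul1r.
exfalso.
have q0 : Dj * D^-1 * u != 0 by apply: contraNneq Fj => q0; rewrite fFj q0 mulr0.
have := congr1 (fun p : R => msize p) fFj; rewrite msizeM //.
have Fh : grad f 0 j \is d.-homog by rewrite gradE; apply: mderiv_homog.
rewrite (msize_homog f0 fh) (msize_homog Fj Fh); move: q0; rewrite -(msize_poly_eq0); case: (msize _) => // n _.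
by rewrite addnS /= addSn => /eqP; rewrite eqSS; clear; lia.
Qed.

End FreeDivisor.

(** * Degrees of the syzygies *)

Section GradedSyz.
Variable k : fieldType.
Hypothesis char0 : [pchar k] =i pred0.
Local Notation R := {mpoly k[3]}.
Variables (f : R) (d : nat).
Hypotheses (f0 : f != 0) (fh : f \is d.+1.-homog).
Implicit Types (s t : 'rV[R]_3).

Definition component n s : 'rV[R]_3 := \row_i pihomog mdeg n (s 0 i).

Lemma grad_homog i : grad f 0 i \is d.-homog.
Proof. by rewrite gradE; apply: mderiv_homog. Qed.

Lemma component_syz n s : s \in syz f -> graded_piece (syz f) n (component n s).
Proof.
move=> /syzP sf; split; last by move=> i; rewrite mxE pihomogP.
apply/syzP; transitivity (pihomog mdeg (d + n) (dot s (grad f))); last by rewrite sf linear0.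
rewrite /dot linear_sum.
by apply: eq_bigr => i _; rewrite /= [s 0 i * _]mulrC pihomogMl ?grad_homog // mxE mulrC.
Qed.

Lemma component_id n s : (forall i, s 0 i \is n.-homog) -> component n s = s.
Proof. by move=> sh; apply/rowP => i; rewrite mxE pihomog_dE. Qed.

Lemma syz_lin_comb (a b : R) s t : s \in syz f -> t \in syz f ->
  a *: s + b *: t \in syz f.
Proof.
move=> /syzP sf /syzP tf; apply/syzP.
transitivity (a * dot s (grad f) + b * dot t (grad f)); last by rewrite sf tf !mulr0 addr0.
by rewrite /dot !mulr_sumr -big_split; apply: eq_bigr => i _; rewrite !mxE /=; ring.
Qed.

Lemma koszul_graded i : graded_piece (syz f) d (koszul (grad f) i).
Proof.
split; first by apply/syzP; apply: koszul_dot.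
have c_homog (b b' : bool) j l : b%:R * f^`M(j) - b'%:R * f^`M(l) \is d.-homog.
  by rewrite rpredB // mulr_natl rpredMn // mderiv_homog.
move=> j; rewrite /koszul /cross mxE ![delta_mx _ _ _ _]mxE /= !gradE.
by case: ifP => _; [|case: ifP => _]; apply: c_homog.
Qed.

Lemma indeg_le e : is_indeg (syz f) e -> (e <= d)%N.
Proof.
move=> [_ low]; rewrite leqNgt; apply/negP => de.
have K0 i := low d de _ (koszul_graded i).
have [i Fi] := exists_coord_neq0 (grad_neq0 char0 f0 fh).
have [E0 E1 E2] := cross_koszul (grad f).
rewrite !K0 in E0 E1 E2.
rewrite !cross0r in E0 E1 E2.
have sq j : grad f 0 j *: grad f = 0 -> grad f 0 j = 0.
  move=> /(congr1 (fun v : 'rV_3 => v 0 j)); rewrite mxE [RHS]mxE => /eqP.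
  by rewrite mulf_eq0 orbb => /eqP.
by case/eqP: Fi; move: i; apply: forall_ord3; apply: sq; symmetry.
Qed.

Lemma indeg_uniq e e' : is_indeg (syz f) e -> is_indeg (syz f) e' -> e = e'.
Proof.
move=> [[s sS s0] low] [[s' sS' s0'] low'].
apply/eqP; rewrite eqn_leq [(e <= e')%N]leqNgt [(e' <= e)%N]leqNgt.
apply/andP; split; apply/negP => lt.
  by case/eqP: s0'; apply: low sS'.
by case/eqP: s0; apply: low' sS.
Qed.

(** Write eps = a1 b1 + a2 b2. Below degree e the components of b1 and b2 vanish, so the degree e
    part of eps sees only the constant terms of a1 and a2, and one of these is nonzero. Crossing eps
    with the other basis vector gives, up to sign, that a_i times c grad f; the degree d part is the
    required equation. *)
Lemma free_syz_eta e eps : prime_elt f -> free_divisor f -> is_indeg (syz f) e ->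
  graded_piece (syz f) e eps -> eps != 0 ->
  exists eta (c : k), [/\ graded_piece (syz f) (d - e) eta, c != 0
    & cross eps eta = c%:MP *: grad f].
Proof.
move=> fP ffree ind [epsS epsh] eps0.
have [b1 [b2 [b1S b2S bspan [c c0 wE]]]] := free_syz_cross char0 fP fh ffree.
have [a1 [a2 epsE]] := bspan _ epsS.
have low b : b \in syz f -> forall i j, (j < e)%N -> pihomog mdeg j (b 0 i) = 0.
  move=> bS i j je; have := ind.2 _ je _ (component_syz j bS).
  by move/(congr1 (fun v : 'rV_3 => v 0 i)); rewrite !mxE.
have [b [a [bS a0 cE]]] : exists b a, [/\ b \in syz f, a@_0%MM != 0
    & cross eps b = a *: grad f].
  have [a10|a10] := eqVneq a1@_0%MM 0; last first.
    exists b2, (c%:MP * a1); split=> //.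
      by rewrite (rmorphM (mcoeff 0%MM)) /= mcoeffC eqxx mulr1 mulf_neq0.
    rewrite mulrC -scalerA -wE epsE.
    have := cross_lin_comb a1 a2 0 1 b1 b2.
    by rewrite !(scale0r, scale1r, add0r, mulr0, subr0, mulr1).
  exists b1, (- (c%:MP * a2)); split=> //.
    rewrite mcoeffN (rmorphM (mcoeff 0%MM)) /= mcoeffC eqxx mulr1 oppr_eq0 mulf_neq0 //.
    apply: contraNneq eps0 => a20; apply/eqP/rowP => i; rewrite [RHS]mxE.
    rewrite -(pihomog_dE (epsh i)) epsE !mxE pihomogD.
    rewrite !pihomogM_lowest; try exact: low.
    by rewrite a10 a20 !scale0r addr0.
  rewrite mulrC scaleNr -scalerA -wE epsE.
  have := cross_lin_comb a1 a2 1 0 b1 b2.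
  by rewrite !(scale0r, scale1r, addr0, mulr0, sub0r, mulr1) scaleNr.
exists (component (d - e) b), a@_0%MM; split=> //; first exact: component_syz.
have ed := indeg_le ind.
have comp_cross i j : eps 0 i * pihomog mdeg (d - e) (b 0 j)
    - eps 0 j * pihomog mdeg (d - e) (b 0 i)
  = pihomog mdeg d (eps 0 i * b 0 j - eps 0 j * b 0 i).
  have pM x y : pihomog mdeg d (eps 0 x * b 0 y) = eps 0 x * pihomog mdeg (d - e) (b 0 y).
    by rewrite -{1}(subnKC ed) pihomogMl ?epsh.
  by rewrite pihomogB !pM.
have low_grad i j : (j < d)%N -> pihomog mdeg j (grad f 0 i) = 0.
  by move=> jd; apply: pihomog_ne0 (grad_homog i); rewrite neq_ltn jd orbT.
have rhs i : (a@_0%MM)%:MP * grad f 0 i = pihomog mdeg d (a * grad f 0 i).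
  rewrite pihomogM_lowest ?mul_mpolyC; last exact: low_grad.
  by rewrite pihomog_dE ?grad_homog.
have cc j : cross eps b 0 j = a * grad f 0 j by rewrite cE mxE.
apply: rowP3; rewrite !row3E [RHS]mxE rhs -cc row3E -comp_cross !mxE //.
Qed.

(** If d - e < e, the partner of eps vanishes by minimality of e, and c grad f with it. *)
Lemma free_indeg_double e : prime_elt f -> free_divisor f -> is_indeg (syz f) e ->
  (e + e <= d)%N.
Proof.
move=> fP ffree ind; have [[eps epsS eps0] low] := ind.
have [eta [c [etaS c0 E]]] := free_syz_eta fP ffree ind epsS eps0.
have ed := indeg_le ind.
rewrite -leq_subRL // leqNgt; apply/negP => lt.
have [i Fi] := exists_coord_neq0 (grad_neq0 char0 f0 fh).
have := congr1 (fun v : 'rV_3 => v 0 i) E.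
rewrite (low _ lt _ etaS) [RHS]mxE => H.
have z0 : cross eps 0 0 i = 0 by rewrite cross0r mxE.
move: H; rewrite z0 => /esym/eqP; rewrite mulf_eq0 (negbTE Fi) orbF mpolyC_eq0.
by rewrite (negbTE c0).
Qed.

End GradedSyz.

(** * Linear vector fields annihilating an irreducible form *)

(** The source of the geometric divisibilities below: when two substitutions agree modulo g and one
    of them kills f, then g divides the image of f under the other. *)
Lemma rmorph_congruence (n : nat) (K : nzRingType) (B : idomainType)
    (phi psi : {rmorphism {mpoly K[n]} -> B}) (g : B) :
  (forall c, phi c%:MP = psi c%:MP) ->
  (forall i, divides g (phi 'X_i - psi 'X_i)) ->
  forall p, divides g (phi p - psi p).
Proof.
move=> EC EX; elim/mpoly_ring_ind => [c|i|p q [x Ex] [y Ey]|p q [x Ex] [y Ey]] //.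
- by exists 0; rewrite EC subrr mulr0.
- exists (x + y); rewrite !rmorphD mulrDr -Ex -Ey; ring.
- exists (x * phi q + psi p * y).
  rewrite !rmorphM mulrDr !mulrA -Ex [g * psi p]mulrC -mulrA -Ey; ring.
Qed.

Lemma substitution (n : nat) (K : comNzRingType) (h : 'I_n -> {mpoly K[n]}) :
  exists psi : {rmorphism {mpoly K[n]} -> {mpoly K[n]}},
    (forall c, psi c%:MP = c%:MP) /\ (forall i, psi 'X_i = h i).
Proof.
exists (comp_mpoly [tuple h i | i < n]); split=> [c|i]; first exact: comp_mpolyC.
by rewrite [LHS]comp_mpolyXU -tnth_nth tnth_mktuple.
Qed.

(** * Restriction to lines and planes *)

Section Lines.
Variable k : fieldType.
Hypothesis char0 : [pchar k] =i pred0.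
Local Notation R := {mpoly k[3]}.
Implicit Types (f : R) (p q r v w : 'rV[k]_3).

Definition line_coord p q (i : 'I_3) : {poly k} := (p 0 i)%:P + (q 0 i)%:P * 'X.

(** The restriction of f to s -> p + s q, a chart of the projective line through p and q that misses
    q; [line q p] is the other chart. *)
Definition line p q : R -> {poly k} := mmap (@polyC k) (line_coord p q).
HB.instance Definition _ p q := GRing.RMorphism.on (line p q).

Arguments line : simpl never.

Lemma lineC p q c : line p q c%:MP = c%:P.
Proof. exact: mmapC. Qed.

Lemma lineX p q i : line p q 'X_i = line_coord p q i.
Proof. by rewrite /line mmapX mmap1U. Qed.

Lemma line_eval p q f s : (line p q f).[s] = f.@[(p + s *: q) 0].
Proof.
apply: (@mpoly_rmorph_ext 3 k k (horner_eval s \o line p q) (meval ((p + s *: q) 0))) => [c|i] /=.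
  by rewrite lineC mevalC /horner_eval hornerC.
by rewrite lineX mevalXU /horner_eval /line_coord !hornerE !mxE mulrC.
Qed.

Lemma line_deriv p q f : (line p q f)^`() = \sum_i line p q f^`M(i) * (q 0 i)%:P.
Proof.
rewrite (@chain_rule 3 k {poly k} (line p q) (@deriv k)).
- by apply: eq_bigr => i _ /=; rewrite lineX /line_coord derivD derivC deriv_mulC derivX add0r mulr1.
- exact: derivD.
- by move=> a b; rewrite derivM.
- by move=> c /=; rewrite lineC derivC.
Qed.

Lemma poly_eqP (P Q : {poly k}) : (forall s, P.[s] = Q.[s]) -> P = Q.
Proof.
move=> E; apply/eqP; rewrite -subr_eq0; apply/eqP/(poly_eval_eq0 char0) => s.
by rewrite !hornerE E subrr.
Qed.

Lemma meval_homog_scale n f (c : k) v : f \is n.-homog ->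
  f.@[(c *: v) 0] = c ^+ n * f.@[v 0].
Proof.
move=> fh; rewrite -(meval_scale_homog _ _ fh).
by apply: meval_eq => i; rewrite mxE.
Qed.

Lemma euler_eval n f v : f \is n.-homog ->
  \sum_i v 0 i * (f^`M(i)).@[v 0] = n%:R * f.@[v 0].
Proof.
move=> /euler_identity E; rewrite -mevalZ -E raddf_sum.
by apply: eq_bigr => i _ /=; rewrite mevalM mevalXU.
Qed.

Definition kills (A : 'M[k]_3) f := forall v, \sum_i (v *m A) 0 i * (f^`M(i)).@[v 0] = 0.

(** At p + s q the field is (lam + al s) p + mu s q. The derivative of f along q is G', and Euler's
    identity gives n G - s G' for the derivative along p. *)
Lemma line_equation n f (A : 'M[k]_3) p q (lam mu al : k) :
  f \is n.-homog -> kills A f -> p *m A = lam *: p -> q *m A = mu *: q + al *: p ->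
  let G := line p q f in
  (lam%:P + al%:P * 'X) * (n%:R *: G - 'X * G^`()) + mu%:P * 'X * G^`() = 0.
Proof.
move=> fh fA pA qA G.
have GE s : (G^`()).[s] = \sum_i q 0 i * (f^`M(i)).@[(p + s *: q) 0].
  rewrite line_deriv horner_sum; apply: eq_bigr => i _.
  by rewrite hornerM hornerC line_eval mulrC.
apply: poly_eqP => s; rewrite !hornerE GE line_eval.
set S := \sum_i _.
set P := \sum_i p 0 i * (f^`M(i)).@[(p + s *: q) 0].
have eul := euler_eval (p + s *: q) fh; rewrite -eul.
have -> : \sum_i (p + s *: q) 0 i * (f^`M(i)).@[(p + s *: q) 0] = P + s * S.
  rewrite /P /S mulr_sumr -big_split; apply: eq_bigr => i _ /=.
  by rewrite !mxE; ring.
have := fA (p + s *: q).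
have -> : \sum_i ((p + s *: q) *m A) 0 i * (f^`M(i)).@[(p + s *: q) 0]
    = lam * P + s * (mu * S + al * P).
  rewrite mulmxDl -scalemxAl pA qA /P /S !mulr_sumr -!big_split mulr_sumr -big_split.
  by apply: eq_bigr => i _ /=; rewrite !mxE; ring.
by move=> <-; ring.
Qed.

Lemma line_swap n f p q s : f \is n.-homog -> s != 0 ->
  (line q p f).[s] = s ^+ n * (line p q f).[s^-1].
Proof.
move=> fh s0; rewrite !line_eval -(meval_homog_scale _ _ fh).
by apply: meval_eq => i; rewrite !mxE; field.
Qed.

Lemma poly_eq_nz (P Q : {poly k}) : (forall s, s != 0 -> P.[s] = Q.[s]) -> P = Q.
Proof.
move=> E; apply/eqP; rewrite -subr_eq0; apply/eqP/(@poly_nat_eq0 _ char0 _ 1) => i i0.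
rewrite !hornerE E ?subrr //; case: i i0 => // i _; exact: natr_neq0.
Qed.

Lemma line_swap_eq0 n f p q : f \is n.-homog -> line p q f = 0 -> line q p f = 0.
Proof.
move=> fh G0; apply: poly_eq_nz => s s0.
by rewrite (line_swap _ _ fh s0) G0 !horner0 mulr0.
Qed.

Definition linear_form w : R := \sum_i w 0 i *: 'X_i.

Lemma linear_form_eval w v : (linear_form w).@[v 0] = dot v w.
Proof.
rewrite raddf_sum; apply: eq_bigr => i _ /=.
by rewrite mevalZ mevalXU mulrC.
Qed.

Lemma linear_form_homog w : linear_form w \is 1.-homog.
Proof.
by apply: rpred_sum => i _; rewrite rpredZ // dhomogX /= mdeg1.
Qed.

Lemma linear_form_neq0 w : w != 0 -> linear_form w != 0.
Proof.
move=> w0; have [i wi] := exists_coord_neq0 w0.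
apply: contraNneq wi => E; have := linear_form_eval w (delta_mx 0 i).
rewrite E meval0 /dot (bigD1 i) //= mxE !eqxx mul1r big1 ?addr0 => [<- //|j ji].
by rewrite mxE (negbTE ji) andbF mul0r.
Qed.

Lemma homog_unit n f : f \is n.-homog -> f \is a GRing.unit -> n = 0%N.
Proof.
move=> fh fU; have f0 : f != 0 by apply: contraTneq fU => ->; rewrite unitr0.
have := msize_homog f0 fh; move: fU => /andP[/eqP -> _].
by rewrite msizeC; case: (_ != 0) => // -[<-].
Qed.

Lemma unit_msize f : f \is a GRing.unit -> msize f = 1%N.
Proof.
move=> fU; have f0 : f != 0 by apply: contraTneq fU => ->; rewrite unitr0.
move: (f0); case/andP: fU => /eqP -> _; rewrite mpolyC_eq0 msizeC.
by case: eqP.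
Qed.

Lemma irreducible_homog_factor n m f g : irreducible_elt f -> f \is n.-homog ->
  g != 0 -> g \is m.+1.-homog -> divides g f -> n = m.+1.
Proof.
move=> [f0 fU fI] fh g0 gh [h fE].
have h0 : h != 0 by apply: contraNneq f0 => h0; rewrite fE h0 mulr0.
have [gU|hU] := fI _ _ fE; first by have := homog_unit gh gU.
have := msize_homog f0 fh; rewrite fE msizeM // (msize_homog g0 gh) (unit_msize hU).
by rewrite addn1 /= => -[].
Qed.

Definition indep p q := cross p q != 0.

Lemma indep_basis p q : indep p q -> exists r, det3 p q r != 0.
Proof.
move=> pq; have [i ci] := exists_coord_neq0 pq; exists (delta_mx 0 i).
suff -> : det3 p q (delta_mx 0 i) = cross p q 0 i by [].
by move: i {ci}; apply: forall_ord3; rewrite /det3 dotE !row3E !mxE /=; ring.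
Qed.

Lemma basis_decomp p q r v : det3 p q r != 0 ->
  v = (det3 v q r / det3 p q r) *: p + (- det3 v p r / det3 p q r) *: q
      + (det3 v p q / det3 p q r) *: r.
Proof.
move=> D0; have := det3_relation p q r v; set D := det3 p q r in D0 *.
move=> E; apply: (scalerI D0); rewrite -E !scalerDr !scalerA.
rewrite ![D * (_ / D)]mulrC !divfK // scaleNr.
by rewrite /det3 !dotE.
Qed.

(** Projection along r onto the plane of p and q is the substitution X_i - r_i l, congruent to the
    identity modulo the linear form l of that plane. It kills f, so l divides f, which has degree at
    least 2. *)
Lemma plane_not_irreducible n f p q : irreducible_elt f -> f \is n.-homog ->
  (2 <= n)%N -> indep p q -> line p q f = 0 -> False.
Proof.
move=> fI fh n2 pq L0; have [r D0] := indep_basis pq.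
set D := det3 p q r in D0.
have L0' := line_swap_eq0 fh L0.
pose w := D^-1 *: cross p q.
have wE v : dot v w = det3 v p q / D.
  by rewrite /w /det3 !dotE !mxE; field.
pose l := linear_form w.
have [psi [psiC psiX]] := substitution (fun i => 'X_i - r 0 i *: l).
have psi0 : psi f = 0.
  apply: (meval_eq0 char0) => u; pose v : 'rV[k]_3 := \row_i u i.
  have -> : (psi f).@[u] = f.@[(v - dot v w *: r) 0].
    apply: (@mpoly_rmorph_ext 3 k k (meval u \o psi) (meval _)) => [c|i] /=.
      by rewrite psiC !mevalC.
    rewrite psiX mevalB mevalZ mevalXU /l.
    rewrite (@meval_eq _ _ u (v 0)) => [|j]; last by rewrite mxE.
    by rewrite linear_form_eval mevalXU !mxE mulrC.
  have -> : v - dot v w *: r = (det3 v q r / D) *: p + (- det3 v p r / D) *: q.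
    by rewrite {1}[v](basis_decomp v D0) wE addrK.
  move: (det3 v q r / D) (- det3 v p r / D) => a b.
  (* The multiples of q are not seen by [line p q], hence the second chart. *)
  have [->|a0] := eqVneq a 0.
    rewrite scale0r add0r (meval_homog_scale _ _ fh).
    by rewrite -[q]addr0 -(scale0r p) -line_eval L0' horner0 mulr0.
  have -> : a *: p + b *: q = a *: (p + (b / a) *: q).
    by rewrite scalerDr scalerA mulrC divfK.
  by rewrite (meval_homog_scale _ _ fh) -line_eval L0 horner0 mulr0.
have : divides l (f - psi f).
  apply: (@rmorph_congruence _ _ _ idfun psi) => [c|i] /=.
    by rewrite psiC.
  rewrite psiX; exists (r 0 i)%:MP; rewrite mulrC mul_mpolyC; ring.
rewrite psi0 subr0 => lf.
have l0 : l != 0.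
  apply: linear_form_neq0; apply: contraNneq pq => w0.
  by rewrite /indep -(scale1r (cross p q)) -(mulfV D0) -scalerA -/w w0 scaler0.
by have := irreducible_homog_factor fI fh l0 (linear_form_homog w) lf; move: n2; case: n {fh} => [|[|n]].
Qed.

End Lines.

(** * Eigenvectors of a linear field that annihilates f *)

Section FixedPoints.
Variable k : fieldType.
Hypothesis char0 : [pchar k] =i pred0.
Local Notation R := {mpoly k[3]}.
Variables (f : R) (n : nat) (A : 'M[k]_3).
Hypotheses (fI : irreducible_elt f) (fh : f \is n.-homog) (n2 : (2 <= n)%N).
Hypothesis fA : kills A f.
Hypothesis fix0 : forall (p : 'rV[k]_3) (lam : k), p != 0 -> p *m A = lam *: p -> f.@[p 0] = 0.
Implicit Types (p q r v w : 'rV[k]_3) (lam mu : k).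

Lemma indepP p q : (forall a b, a *: p + b *: q = 0 -> a = 0 /\ b = 0) -> indep p q.
Proof.
move=> H; apply/eqP => pq0.
have p0 x : p 0 x = 0.
  have [|_ /eqP] := H (q 0 x) (- p 0 x); last by rewrite oppr_eq0 => /eqP.
  apply/rowP => y; rewrite !mxE (cross_eq0_colinear pq0); ring.
have [|/eqP] := H 1 0; last by rewrite oner_eq0.
by apply/rowP => y; rewrite !mxE p0; ring.
Qed.

Lemma indep_lin_comb p q a b : indep p q -> a *: p + b *: q = 0 -> a = 0 /\ b = 0.
Proof.
move=> pq E; split; apply: contraNeq pq => c0.
  have -> : p = (- b / a) *: q.
    apply: (scalerI c0); apply/eqP; rewrite -subr_eq0 -{1}[a *: p]addr0 -E; apply/eqP.
    by rewrite scalerA mulrC divfK // scaleNr opprK E addr0 [_ + _]E.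
  by have := cross_scale (- b / a) 1 q; rewrite scale1r => ->.
have -> : q = (- a / b) *: p.
  apply: (scalerI c0); rewrite scalerA mulrC divfK // scaleNr.
  by apply/eqP; rewrite -addr_eq0 addrC E.
by have := cross_scale 1 (- a / b) p; rewrite scale1r => ->.
Qed.

Lemma indep_neq0 p q a b : indep p q -> a != 0 -> a *: p + b *: q != 0.
Proof. by move=> pq a0; apply: contraNneq a0 => /(indep_lin_comb pq)[->]. Qed.

Lemma eigenspace_dim1 p q lam : p *m A = lam *: p -> q *m A = lam *: q ->
  ~ indep p q.
Proof.
move=> pA qA pq; apply: (plane_not_irreducible char0 fI fh n2 pq).
apply: (poly_eval_eq0 char0) => s; rewrite line_eval.
apply: (@fix0 _ lam); first by rewrite -[p]scale1r; apply: indep_neq0; rewrite ?oner_neq0.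
by rewrite mulmxDl -scalemxAl pA qA scalerDr !scalerA mulrC.
Qed.

(** Here the line equation reads lam n G + X (n G - X G') = 0. If lam is nonzero it determines each
    coefficient of G from the preceding one, so G = 0 and f vanishes on a plane. *)
Lemma jordan_chain_eigenvalue0 p q lam : p != 0 -> p *m A = lam *: p ->
  q *m A = lam *: q + p -> lam = 0.
Proof.
move=> p0 pA qA.
have pq : indep p q.
  apply: indepP => a b E.
  have E2 : lam *: (a *: p + b *: q) + b *: p = 0.
    have <- : (a *: p + b *: q) *m A = 0 by rewrite E mul0mx.
    rewrite mulmxDl -!scalemxAl pA qA !scalerDr !scalerA addrA.
    by rewrite [lam * a]mulrC [lam * b]mulrC.
  have /eqP : b *: p = 0 by rewrite -[RHS]E2 E scaler0 add0r.
  rewrite scaler_eq0 (negbTE p0) orbF => /eqP b0; split=> //.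
  by have /eqP := E; rewrite b0 scale0r addr0 scaler_eq0 (negbTE p0) orbF => /eqP.
have qA' : q *m A = lam *: q + 1 *: p by rewrite scale1r.
have /= := line_equation char0 fh fA pA qA'; set G := line p q f => eqG.
apply/eqP/negPn/negP => lam0.
apply: (plane_not_irreducible char0 fI fh n2 pq); rewrite -/G.
have {}eqG : (lam * n%:R) *: G + 'X * (n%:R *: G - 'X * G^`()) = 0.
  by rewrite -eqG -!mul_polyC polyCM; ring.
apply/polyP; elim/ltn_ind => m IH; rewrite coef0.
have := congr1 (fun P : {poly k} => P`_m) eqG.
rewrite coefD coefZ coef0 coefXM.
have n0 : n%:R != 0 :> k by case: (n) n2 => // j _; apply: natr_neq0.
case: m IH => [|m] IH /=.
  by rewrite addr0 => /eqP; rewrite !mulf_eq0 (negbTE lam0) (negbTE n0) => /eqP.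
rewrite coefB coefZ coefXM coef_deriv; have := IH m (ltnSn m).
case: m {IH} => [|m] /= E.
  rewrite E coef0 mulr0 subr0 addr0 => /eqP.
  by rewrite !mulf_eq0 (negbTE lam0) (negbTE n0) => /eqP.
rewrite E coef0 mulr0 mul0rn subr0 addr0 => /eqP.
by rewrite !mulf_eq0 (negbTE lam0) (negbTE n0) => /eqP.
Qed.

Lemma distinct_eigenvectors_indep p q lam mu : p != 0 -> q != 0 ->
  p *m A = lam *: p -> q *m A = mu *: q -> lam != mu -> indep p q.
Proof.
move=> p0 q0 pA qA lm; apply: indepP => a b E.
have E2 : (a * lam) *: p + (b * mu) *: q = 0.
  by have := congr1 (mulmx^~ A) E; rewrite mulmxDl -!scalemxAl pA qA !scalerA mul0mx.
have /eqP : (a * (lam - mu)) *: p = 0.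
  transitivity ((a * lam) *: p + (b * mu) *: q - mu *: (a *: p + b *: q)).
    by apply/rowP => y; rewrite !mxE; ring.
  by rewrite E E2 scaler0 subr0.
rewrite scaler_eq0 (negbTE p0) orbF mulf_eq0 subr_eq0 (negbTE lm) orbF => /eqP a0.
split=> //; move: E; rewrite a0 scale0r add0r => /eqP.
by rewrite scaler_eq0 (negbTE q0) orbF => /eqP.
Qed.

(* On the line joining two fixed points f restricts to a monomial of weight 0. *)
Lemma eigenvalues_opposite p q lam mu : p != 0 -> q != 0 ->
  p *m A = lam *: p -> q *m A = mu *: q -> lam != mu ->
  exists a b, a.+1%:R * lam + b.+1%:R * mu = 0.
Proof.
move=> p0 q0 pA qA lm; have pq := distinct_eigenvectors_indep p0 q0 pA qA lm.
have qA' : q *m A = mu *: q + 0 *: p by rewrite scale0r addr0.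
have /= := line_equation char0 fh fA pA qA'; set G := line p q f => eqG.
have [G0|G0] := eqVneq G 0.
  by case: (plane_not_irreducible char0 fI fh n2 pq G0).
have coefG m : (lam * (n%:R - m%:R) + mu * m%:R) * G`_m = 0.
  have := congr1 (fun P : {poly k} => P`_m) eqG.
  rewrite polyC0 mul0r addr0 coef0 -mulrA coefD !coefCM coefB coefZ coefXM coef_deriv.
  case: m => [|m] /=; first by move=> E; rewrite -[RHS]E; ring.
  by rewrite -mulr_natr => E; rewrite -[RHS]E; ring.
have [m Gm] : exists m, G`_m != 0.
  by exists (size G).-1; rewrite -lead_coefE lead_coef_eq0.
have wm : lam * (n%:R - m%:R) + mu * m%:R = 0.
  by have /eqP := coefG m; rewrite mulf_eq0 (negbTE Gm) orbF => /eqP.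
have GE : G = G`_m *: 'X^m.
  apply/polyP => j; rewrite coefZ coefXn; have [->|jm] := eqVneq; first by rewrite mulr1.
  rewrite mulr0; apply/eqP; have /eqP := coefG j; rewrite mulf_eq0 => /orP[/eqP wj|//].
  case/negP: jm; apply/eqP/(natr_inj_char0 char0).
  have : (lam - mu) * (j%:R - m%:R) = 0.
    by rewrite -[RHS](subrr 0) -{1}wm -{1}wj; ring.
  by move/eqP; rewrite mulf_eq0 !subr_eq0 (negbTE lm) => /eqP.
(* The exponent is positive because f vanishes at p, and less than n because, in the other chart, f
   vanishes at q. *)
have m0 : (0 < m)%N.
  rewrite lt0n; apply: contraNneq Gm => ->; rewrite -horner_coef0 line_eval.
  by rewrite scale0r addr0 (fix0 p0 pA).
have mn : (m < n)%N.
  rewrite ltnNge; apply/negP => nm; case/eqP: Gm.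
  have H : 'X^(m - n) * line q p f = (G`_m)%:P.
    apply: (poly_eq_nz char0) => s s0; rewrite hornerM hornerXn hornerC.
    rewrite (line_swap _ _ fh s0) -/G {1}GE hornerZ hornerXn !mulrA -exprD subnK //.
    by rewrite mulrAC -exprMn divff // expr1n mul1r.
  have := congr1 (fun P : {poly k} => P.[0]) H.
  rewrite hornerM hornerC line_eval scale0r addr0 (fix0 q0 qA) mulr0 => <-.
  by [].
exists (n - m).-1, m.-1; rewrite !prednK ?subn_gt0 // natrB; last exact: ltnW.
by rewrite -[RHS]wm; ring.
Qed.

End FixedPoints.

(** * Nilpotency of the linear field *)

Section Nilpotent.
Variable k : closedFieldType.
Hypothesis char0 : [pchar k] =i pred0.
Local Notation R := {mpoly k[3]}.
Variables (f : R) (n : nat) (A : 'M[k]_3).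
Hypotheses (fI : irreducible_elt f) (fh : f \is n.-homog) (n2 : (2 <= n)%N).
Hypothesis fA : kills A f.
Hypothesis fix0 : forall (p : 'rV[k]_3) (lam : k),
  p != 0 -> p *m A = lam *: p -> f.@[p 0] = 0.
Implicit Types (p q r v w : 'rV[k]_3) (lam mu : k).

Let B lam : 'M[k]_3 := A - lam%:M.

Lemma eigenvector_sub lam p : p *m B lam = 0 -> p *m A = lam *: p.
Proof. by rewrite mulmxBr mul_mx_scalar => /eqP; rewrite subr_eq0 => /eqP. Qed.

(** A kernel of dimension 2 would contain two independent eigenvectors for one eigenvalue. *)
Lemma rank_sub_eigenvalue lam : (2 <= \rank (B lam))%N.
Proof.
rewrite leqNgt; apply/negP => rB.
have : (2 <= \rank (kermx (B lam)))%N.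
  by rewrite mxrank_ker leq_subRL ?rank_leq_row //; move: rB; case: (\rank _) => [|[|]].
set K := kermx _ => rK.
pose i0 := Ordinal (ltnW rK); pose i1 := Ordinal rK.
have KA i : row i (row_base K) *m A = lam *: row i (row_base K).
  apply: eigenvector_sub; apply/sub_kermxP; rewrite -/K.
  by apply: submx_trans (row_sub _ _) _; rewrite eq_row_base.
apply: (eigenspace_dim1 char0 fI fh n2 fix0 (KA i0) (KA i1)).
apply: indepP => a b E.
have : a *: delta_mx 0 i0 + b *: delta_mx 0 i1 = 0 :> 'rV[k]_(\rank K).
  apply: (row_free_inj (row_base_free K)).
  by rewrite mul0mx mulmxDl -!scalemxAl -!rowE.
move=> H; split.
  by have := congr1 (fun v : 'rV_(\rank K) => v 0 i0) H; rewrite !mxE /= mulr1 mulr0 addr0.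
by have := congr1 (fun v : 'rV_(\rank K) => v 0 i1) H; rewrite !mxE /= mulr1 mulr0 add0r.
Qed.

(** Two endomorphisms of rank at least 2 in dimension 3 cannot compose to zero, as 2 + 2 > 3. *)
Lemma mul_sub_neq0 lam mu : B lam *m B mu != 0.
Proof.
apply/eqP => /mulmx0_rank_max; rewrite leqNgt => /negP; apply.
exact: leq_trans (leq_add (rank_sub_eigenvalue lam) (rank_sub_eigenvalue mu)).
Qed.

Lemma mulmx_eq0P (m : nat) (C : 'M[k]_(3, m)) : (forall v, v *m C = 0) -> C = 0.
Proof. by move=> H; apply/row_matrixP => i; rewrite row0 rowE H. Qed.

(** The product of the first two factors is nonzero, so some v gives a Jordan chain for lam: q = v
    (A - mu) and p = q (A - lam). *)
Lemma eigenvalue0_of_double lam mu :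
  B mu *m B lam *m B lam = 0 -> lam = 0.
Proof.
move=> E; apply: NNPP => lam0.
case/eqP: (mul_sub_neq0 mu lam); apply: mulmx_eq0P => v.
rewrite mulmxA; set q := v *m B mu; apply: NNPP => /eqP p0.
apply: lam0; apply: (jordan_chain_eigenvalue0 char0 fI fh n2 fA p0 (q := q)).
  by apply: eigenvector_sub; rewrite /q -!mulmxA [B mu *m _]mulmxA E mulmx0.
by rewrite mulmxBr mul_mx_scalar addrC subrK.
Qed.

Lemma char_poly_split3 : exists a b c,
  [/\ B a *m B b *m B c = 0, eigenvalue A a, eigenvalue A b & eigenvalue A c].
Proof.
have [rs rsE] := closed_field_poly_normal (char_poly A).
rewrite (monicP (char_poly_monic A)) scale1r in rsE.
have := size_char_poly A; rewrite rsE size_prod_XsubC => -[].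
case: rs rsE => [|a [|b [|c [|]]]] // rsE _; exists a, b, c.
have ev x : x \in [:: a; b; c] -> eigenvalue A x.
  by move=> xin; rewrite eigenvalue_root_char rsE root_prod_XsubC.
split; try by apply: ev; rewrite !inE eqxx ?orbT.
have := Cayley_Hamilton A; rewrite rsE !big_cons big_nil mulr1.
rewrite !rmorphM /= !rmorphB /= horner_mx_X !horner_mx_C mulrA.
by [].
Qed.

Lemma eigenvalueE lam : eigenvalue A lam -> exists2 p : 'rV[k]_3, p != 0 & p *m A = lam *: p.
Proof. by move=> /eigenvalueP[p pA p0]; exists p. Qed.

Lemma eigenvalues_weights lam mu : eigenvalue A lam -> eigenvalue A mu ->
  lam != mu -> exists a b, a.+1%:R * lam + b.+1%:R * mu = 0.
Proof.
move=> /eigenvalueE[p p0 pA] /eigenvalueE[q q0 qA].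
exact: (eigenvalues_opposite char0 fI fh n2 fA fix0 p0 q0 pA qA).
Qed.

Lemma eigenvalue_eq0 lam mu : eigenvalue A lam -> eigenvalue A mu ->
  mu = 0 -> lam = 0.
Proof.
move=> El Em mu0; apply/eqP/negPn/negP => lam0.
have [|a [b]] := eigenvalues_weights El Em; first by rewrite mu0.
move/eqP; rewrite mu0 mulr0 addr0 mulf_eq0 (negbTE lam0) orbF.
by rewrite (negbTE (natr_neq0 char0 a)).
Qed.

Lemma subC lam mu : B lam *m B mu = B mu *m B lam.
Proof.
rewrite /B !mulmxBl !mulmxBr !mul_scalar_mx !mul_mx_scalar !opprB.
rewrite !scale_scalar_mx [mu * lam]mulrC -!addrA; congr (_ + _).
by rewrite addrCA [RHS]addrCA [- _ - _]addrC.
Qed.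

(** If one eigenvalue is 0, all are, and Cayley-Hamilton concludes. Repeated nonzero eigenvalues are
    excluded by commuting the factors so that [eigenvalue0_of_double] applies; three distinct ones
    by a sign argument. *)
Lemma cube_eq0 : A *m A *m A = 0.
Proof.
have [a [b [c [E Ea Eb Ec]]]] := char_poly_split3.
have A0 : B 0 = A by rewrite /B -scalemx1 scale0r subr0.
have [a0|a0] := eqVneq a 0.
  have b0 := eigenvalue_eq0 Eb Ea a0; have c0 := eigenvalue_eq0 Ec Ea a0.
  by move: E; rewrite a0 b0 c0 A0.
have b0 : b != 0 by apply: contra_neq a0; apply: eigenvalue_eq0.
have c0 : c != 0 by apply: contra_neq a0; apply: eigenvalue_eq0.
have [bc|bc] := eqVneq b c.
  by move: E; rewrite -bc => /eigenvalue0_of_double E; rewrite E eqxx in b0.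
have [ac|ac] := eqVneq a c.
  by move: E; rewrite -ac (subC a b) => /eigenvalue0_of_double E; rewrite E eqxx in a0.
have [ab|ab] := eqVneq a b.
  move: E; rewrite -ab -mulmxA (subC a c) mulmxA (subC a c).
  by move=> /eigenvalue0_of_double E; rewrite E eqxx in a0.
have [i1 [j1 E1]] := eigenvalues_weights Ea Eb ab.
have [i2 [j2 E2]] := eigenvalues_weights Eb Ec bc.
have [|i3 [j3 E3]] := eigenvalues_weights Ec Ea _; first by rewrite eq_sym.
(* Each of the ratios a/b, b/c and c/a is a negative rational, yet their product is 1; clearing
   denominators gives a positive integer that kills a. *)
have : (i1.+1 * i2.+1 * i3.+1 + j1.+1 * j2.+1 * j3.+1)%N%:R * a = 0.
  rewrite natrD !natrM.
  transitivity (i2.+1%:R * i3.+1%:R * (i1.+1%:R * a + j1.+1%:R * b)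
    - j1.+1%:R * i3.+1%:R * (i2.+1%:R * b + j2.+1%:R * c)
    + j1.+1%:R * j2.+1%:R * (i3.+1%:R * c + j3.+1%:R * a)).
    by move: (i1.+1%:R) (i2.+1%:R) (i3.+1%:R) (j1.+1%:R) (j2.+1%:R) (j3.+1%:R) => *; ring.
  by rewrite E1 E2 E3 !mulr0 subr0 addr0.
by move/eqP; rewrite mulf_eq0 (negbTE a0) orbF (pcharf0P k).1.
Qed.

Lemma nilpotent_chain : exists p q r : 'rV[k]_3, [/\ p != 0, p *m A = 0, q *m A = p & r *m A = q].
Proof.
have A2 : A *m A != 0.
  by have := mul_sub_neq0 0 0; rewrite /B -scalemx1 scale0r subr0.
have [r r0] : exists r, r *m (A *m A) != 0.
  apply: NNPP => H; case/eqP: A2; apply: mulmx_eq0P => v.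
  by apply: NNPP => /eqP v0; apply: H; exists v.
exists (r *m (A *m A)), (r *m A), r; split=> //; last by rewrite mulmxA.
by rewrite -!mulmxA [A *m (A *m A)]mulmxA cube_eq0 mulmx0.
Qed.

Lemma chain_det3_neq0 p q r : p != 0 -> p *m A = 0 -> q *m A = p -> r *m A = q ->
  indep p q /\ det3 p q r != 0.
Proof.
move=> p0 pA qA rA.
have pq : indep p q.
  apply: indepP => a b E.
  have b0 : b = 0.
    have := congr1 (mulmx^~ A) E; rewrite mulmxDl -!scalemxAl pA qA mul0mx scaler0 add0r.
    by move/eqP; rewrite scaler_eq0 (negbTE p0) orbF => /eqP.
  split=> //; move/eqP: E; rewrite b0 scale0r addr0 scaler_eq0 (negbTE p0) orbF.
  by move/eqP.
split=> //; apply: contraTneq isT => D0.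
have [i ci] := exists_coord_neq0 pq.
have := det3_relation p q r (delta_mx 0 i); rewrite D0 scale0r.
have -> : det3 (delta_mx 0 i) p q = cross p q 0 i.
  rewrite /det3 /dot (bigD1 i) //= mxE !eqxx mul1r big1 ?addr0 // => j /negbTE ji.
  by rewrite mxE ji andbF mul0r.
move: (cross p q 0 i) ci (det3 _ _ _) (det3 _ _ _) => c c0 a b E.
have := congr1 (mulmx^~ A) E.
rewrite mulmxDl mulmxBl -!scalemxAl pA qA rA mul0mx scaler0 sub0r -scaleNr => E'.
by have [_ /eqP] := indep_lin_comb pq E'; rewrite (negbTE c0).
Qed.
End Nilpotent.

(** * The invariant conic of a nilpotent field *)

Section Conic.
Variable k : closedFieldType.
Hypothesis char0 : [pchar k] =i pred0.
Local Notation R := {mpoly k[3]}.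
Variables (f : R) (n : nat) (A : 'M[k]_3).
Hypotheses (fI : irreducible_elt f) (fh : f \is n.-homog).
Hypothesis fA : kills A f.
Implicit Types (p q r v w : 'rV[k]_3).

Lemma two_neq0 : 2%:R != 0 :> k.
Proof. exact: natr_neq0. Qed.

Lemma deriv_eq0_const (P : {poly k}) : P^`() = 0 -> P = (P.[0])%:P.
Proof.
move=> P'0; rewrite horner_coef0; apply/polyP => -[|j]; rewrite coefC //=.
have := congr1 (fun Q : {poly k} => Q`_j) P'0; rewrite coef_deriv coef0 -mulr_natr.
by move/eqP; rewrite mulf_eq0 (negbTE (natr_neq0 char0 j)) orbF => /eqP.
Qed.

(** For p A = 0, q A = p and r A = q this is the orbit of r + s p under exp(tA), namely r + t q + (s
    + t^2/2) p. *)
Definition parabola_coord p q r (s : k) (i : 'I_3) : {poly k} :=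
  (s%:P + 2%:R^-1 *: 'X^2) * (p 0 i)%:P + 'X * (q 0 i)%:P + (r 0 i)%:P.

Definition parabola p q r (s : k) : R -> {poly k} :=
  mmap (@polyC k) (parabola_coord p q r s).
HB.instance Definition _ p q r s := GRing.RMorphism.on (parabola p q r s).
Arguments parabola : simpl never.

Lemma parabola_eval p q r s g t :
  (parabola p q r s g).[t] = g.@[((s + t ^+ 2 / 2%:R) *: p + t *: q + r) 0].
Proof.
apply: (@mpoly_rmorph_ext 3 k k (horner_eval t \o parabola p q r s) (meval _)) => [c|i] /=.
  by rewrite /parabola mmapC mevalC /horner_eval hornerC.
rewrite /parabola mmapX mmap1U mevalXU /horner_eval /parabola_coord.
by rewrite !(hornerD, hornerM, hornerC, hornerZ, hornerXn, hornerX) !mxE; ring.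
Qed.

Lemma parabola_deriv p q r s g : (parabola p q r s g)^`() =
  \sum_i parabola p q r s g^`M(i) * ('X * (p 0 i)%:P + (q 0 i)%:P).
Proof.
rewrite (@chain_rule 3 k {poly k} (parabola p q r s) (@deriv k)).
- apply: eq_bigr => i _ /=; congr (_ * _).
  rewrite /parabola mmapX mmap1U /parabola_coord.
  rewrite !(derivD, derivM, derivC, derivZ, derivXn, derivX) /=.
  have E : 2%:R^-1 *: (1 * 'X + 'X * 1) = 'X :> {poly k}.
    by rewrite mul1r mulr1 -mulr2n -scaler_nat scalerA mulVf ?two_neq0 // scale1r.
  by rewrite E; ring.
- exact: derivD.
- by move=> a b; rewrite derivM.
- by move=> c /=; rewrite /parabola mmapC derivC.
Qed.

Variables (p q r : 'rV[k]_3).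
Hypotheses (pq : indep p q) (D0 : det3 p q r != 0).
Hypotheses (pA : p *m A = 0) (qA : q *m A = p) (rA : r *m A = q).

(* The field is tangent to these parabolas, so f is constant along them. *)
Lemma parabola_const s : parabola p q r s f = (f.@[(r + s *: p) 0])%:P.
Proof.
have : (parabola p q r s f)^`() = 0.
  apply: (poly_eval_eq0 char0) => t; rewrite parabola_deriv horner_sum.
  have := fA ((s + t ^+ 2 / 2%:R) *: p + t *: q + r).
  rewrite !mulmxDl -!scalemxAl pA qA rA scaler0 add0r => E.
  rewrite -[RHS]E; apply: eq_bigr => i _.
  by rewrite hornerM parabola_eval !hornerE !mxE mulrC.
move/deriv_eq0_const ->; rewrite parabola_eval; congr (_%:P).
by apply: meval_eq => i; rewrite !mxE; ring.
Qed.

(** The field equals p all along q + t p, so f is constant there; if f(q) = 0 then f vanishes on the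
    plane of p and q. *)
Lemma line_pq_neq0 : (2 <= n)%N -> f.@[q 0] != 0.
Proof.
move=> n2; apply/eqP => fq.
have qp : indep q p.
  by rewrite /indep crossC oppr_eq0.
apply: (plane_not_irreducible char0 fI fh n2 qp).
have : (line q p f)^`() = 0.
  apply: (poly_eval_eq0 char0) => t; rewrite line_deriv horner_sum.
  have := fA (q + t *: p); rewrite mulmxDl -scalemxAl qA pA scaler0 addr0 => E.
  rewrite -[RHS]E; apply: eq_bigr => i _.
  by rewrite hornerM line_eval hornerC mulrC.
by move/deriv_eq0_const ->; rewrite line_eval scale0r addr0 fq.
Qed.

(** A root c of f(r + s p) gives the parabola. Without a root f(r + s p) is a constant c0; the
    parabola with s = -t^2/2 passes through r + t q, so f(r + t q) = c0 as well, and homogeneity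
    forces f(q) = 0. *)
Lemma exists_parabola : (2 <= n)%N -> exists c, parabola p q r c f = 0.
Proof.
move=> n2.
suff /closed_rootP[c /rootP cr] : size (line r p f) != 1.
  by exists c; rewrite parabola_const -(line_eval r p) cr.
apply/negP => /size_poly1P[c0 _ E].
have lrq : line r q f = c0%:P.
  apply: (poly_eqP char0) => t; rewrite line_eval hornerC.
  have := parabola_eval p q r (- (t ^+ 2 / 2%:R)) f t.
  rewrite parabola_const hornerC -(line_eval r p) E hornerC => ->.
  by rewrite addNr scale0r add0r addrC.
case/eqP: (line_pq_neq0 n2).
have lqr : line q r f = c0 *: 'X^n.
  apply: (poly_eq_nz char0) => s s0.
  by rewrite (line_swap _ _ fh s0) lrq hornerC hornerZ hornerXn mulrC.
have := congr1 (fun P : {poly k} => P.[0]) lqr.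
rewrite line_eval scale0r addr0 => ->; rewrite hornerZ hornerXn expr0n.
by case: (n) n2 => // m _; rewrite mulr0.
Qed.

(** In coordinates x, y, z dual to p, q, r the parabola is the chart z = 1 of g = x z - y^2/2 - c
    z^2. The substitution [psi] sends a point to z^2 times the parabola point with parameter y/z, so
    it kills f; it agrees modulo g with multiplication by z, because x z is congruent to y^2/2 + c
    z^2. Hence g divides z^n f, and z is prime to g. *)
Lemma parabola_conic_divides c : (0 < n)%N -> parabola p q r c f = 0 ->
  exists g, [/\ g != 0, g \is 2.-homog & divides g f].
Proof.
move=> n0 par0; have D0' := D0; set D := det3 p q r in D0'.
pose wx := D^-1 *: cross q r; pose wy := - D^-1 *: cross p r.
pose wz := D^-1 *: cross p q.
have [x [xh xE]] : exists x, x \is 1.-homog /\ forall v, x.@[v 0] = det3 v q r / D.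
  exists (linear_form wx); split=> [|v]; first exact: linear_form_homog.
  by rewrite linear_form_eval /det3 !dotE !mxE; field.
have [y [yh yE]] : exists y, y \is 1.-homog /\ forall v, y.@[v 0] = - det3 v p r / D.
  exists (linear_form wy); split=> [|v]; first exact: linear_form_homog.
  by rewrite linear_form_eval /det3 !dotE !mxE; field.
have [z [zh zE zP]] : exists z, [/\ z \is 1.-homog, forall v, z.@[v 0] = det3 v p q / D & prime_elt z].
  exists (linear_form wz); split=> [|v|]; first exact: linear_form_homog.
    by rewrite linear_form_eval /det3 !dotE !mxE; field.
  apply: homog1_prime; last exact: linear_form_homog.
  apply: linear_form_neq0; apply: contraNneq pq => w0.
  by rewrite /indep -(scale1r (cross p q)) -(mulfV D0') -scalerA -/wz w0 scaler0.
have vE v : v = x.@[v 0] *: p + y.@[v 0] *: q + z.@[v 0] *: r.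
  by rewrite xE yE zE; apply: basis_decomp.
have mevalE' (h : R) u : h.@[u] = h.@[(\row_i u i : 'rV[k]_3) 0].
  by apply: meval_eq => i; rewrite mxE.
have XE i : 'X_i = p 0 i *: x + q 0 i *: y + r 0 i *: z :> R.
  apply/eqP; rewrite -subr_eq0; apply/eqP/(meval_eq0 char0) => u.
  rewrite mevalE'; set v := \row_i u i.
  rewrite mevalB mevalXU !mevalD !mevalZ {1}(vE v) !mxE; ring.
pose g := x * z - 2%:R^-1 *: (y * y) - c *: (z * z).
have gh : g \is 2.-homog.
  have hM (a b : R) : a \is 1.-homog -> b \is 1.-homog -> a * b \is 2.-homog.
    by move=> ah bh; apply: (@dhomogM _ _ _ 1 _ 1).
  by rewrite !rpredB ?rpredZ ?hM.
(* The point q has z = 0, so this one value shows both that g is nonzero and that z does not divide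
   g. *)
have gq : g.@[q 0] = - 2%:R^-1.
  rewrite !mevalB !mevalZ !mevalM xE yE zE.
  have -> : det3 q q r = 0 by rewrite /det3 !dotE !row3E; ring.
  have -> : det3 q p q = 0 by rewrite /det3 !dotE !row3E; ring.
  have -> : det3 q p r = - D by rewrite /D /det3 !dotE !row3E; ring.
  by rewrite opprK divff // !mul0r mulr0 !subr0 sub0r !mulr1.
have h2 : - 2%:R^-1 != 0 :> k by rewrite oppr_eq0 invr_eq0 two_neq0.
have g0 : g != 0 by apply: contraNneq h2 => E; rewrite -gq E meval0.
have zg : ~ divides z g.
  move=> [h hE]; case/eqP: h2; rewrite -gq hE mevalM zE.
  have -> : det3 q p q = 0 by rewrite /det3 !dotE !row3E; ring.
  by rewrite !mul0r.
exists g; split=> //.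
have [phi [phiC phiX]] := substitution (fun i => z * 'X_i : R).
have [psi [psiC psiX]] := substitution (fun i => p 0 i *: (2%:R^-1 *: (y * y) + c *: (z * z)) + q 0 i *: (y * z) + r 0 i *: (z * z) : R).
have phif : phi f = z ^+ n * f.
  apply/eqP; rewrite -subr_eq0; apply/eqP/(meval_eq0 char0) => u.
  rewrite mevalB mevalM; apply/eqP; rewrite subr_eq0; apply/eqP.
  rewrite (rmorphXn (meval u)) /= -(meval_scale_homog _ _ fh).
  apply: (@mpoly_rmorph_ext 3 k k (meval u \o phi) (meval _)) => [a|i] /=.
    by rewrite phiC !mevalC.
  by rewrite phiX mevalM !mevalXU.
have psif : psi f = 0.
  (* The parameter y/z needs z nonzero; the extra factor z takes care of the other points. *)
  apply/eqP; suff : z * psi f == 0 by rewrite mulf_eq0; case: zP => /negbTE ->.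
  apply/eqP/(meval_eq0 char0) => u; rewrite mevalM.
  have [->|z0] := eqVneq (z.@[u]) 0; first by rewrite mul0r.
  suff -> : (psi f).@[u] = 0 by rewrite mulr0.
  set t := y.@[u] / z.@[u].
  have := parabola_eval p q r c f t; rewrite par0 horner0.
  set v := _ + r => fv.
  transitivity (f.@[(z.@[u] ^+ 2 *: v) 0]).
    apply: (@mpoly_rmorph_ext 3 k k (meval u \o psi) (meval _)) => [a|i] /=.
      by rewrite psiC !mevalC.
    rewrite psiX !mevalD !mevalZ !mevalD !mevalZ !mevalM mevalXU /v !mxE /t.
    by move: (y.@[u]) (z.@[u]) z0 two_neq0 => yu zu z0 two0; field; rewrite two0 z0.
  by rewrite (meval_homog_scale _ _ fh) -fv mulr0.
have : divides g (phi f - psi f).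
  apply: (@rmorph_congruence _ _ _ phi psi) => [a|i]; first by rewrite phiC psiC.
  exists (p 0 i)%:MP; rewrite phiX psiX XE /g -!mul_mpolyC.
  by move: (_%:MP) (_%:MP) (_%:MP) (_%:MP) (_%:MP) => *; ring.
rewrite phif psif subr0 => -[h E].
apply: (@cancel_primes _ (nseq n z) g f h) => [a|].
  by rewrite mem_nseq => /andP[_ /eqP ->].
by rewrite big_nseq -Monoid.iteropE; exact: E.
Qed.

End Conic.

(** * Cones and syzygies of degree one *)

Section LowDegree.
Variable k : closedFieldType.
Hypothesis char0 : [pchar k] =i pred0.
Local Notation R := {mpoly k[3]}.
Variables (f : R) (d : nat).
Hypotheses (fI : irreducible_elt f) (fh : f \is d.+1.-homog) (d1 : (1 <= d)%N).
Implicit Types (p q r v w : 'rV[k]_3).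

Lemma det3_indep p q r : det3 p q r != 0 -> indep p q.
Proof.
apply: contraNN => /eqP E.
have -> : det3 p q r = dot r (cross p q) by rewrite /det3 !dotE !row3E; ring.
by rewrite E /dot big1 // => i _; rewrite mxE mulr0.
Qed.

Lemma neq0_basis p : p != 0 -> exists q r, det3 p q r != 0.
Proof.
move=> p0; have [i] := exists_coord_neq0 p0.
move: i; apply: forall_ord3 => pi.
- exists (delta_mx 0 o1), (delta_mx 0 o2); apply: contraNneq pi => <-.
  by rewrite /det3 dotE !row3E !mxE /=; apply/eqP; ring.
- exists (delta_mx 0 o2), (delta_mx 0 o0); apply: contraNneq pi => <-.
  by rewrite /det3 dotE !row3E !mxE /=; apply/eqP; ring.
- exists (delta_mx 0 o0), (delta_mx 0 o1); apply: contraNneq pi => <-.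
  by rewrite /det3 dotE !row3E !mxE /=; apply/eqP; ring.
Qed.

(** f would be constant along the direction p, so a zero q off the line of p would make f vanish on
    their plane. On q + t r either f has a root, or it is constant and then, by homogeneity, f(r) =
    0. *)
Lemma irreducible_not_cone p : p != 0 ->
  ~ (forall v, \sum_i p 0 i * (f^`M(i)).@[v 0] = 0).
Proof.
move=> p0 Dp; have lineE v : line v p f = (f.@[v 0])%:P.
  have /(deriv_eq0_const char0) -> : (line v p f)^`() = 0.
    apply: (poly_eval_eq0 char0) => t; rewrite line_deriv horner_sum.
    rewrite -[RHS](Dp (v + t *: p)); apply: eq_bigr => i _.
    by rewrite hornerM line_eval hornerC mulrC.
  by rewrite line_eval scale0r addr0.
suff [q pq fq] : exists2 q, indep p q & f.@[q 0] = 0.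
  apply: (plane_not_irreducible char0 fI fh (p := q) (q := p)) => //.
    by rewrite /indep crossC oppr_eq0.
  by rewrite lineE fq.
have [q [r D0]] := neq0_basis p0.
have [|/negPn/size_poly1P[c c0 E]] := boolP (size (line q r f) != 1).
  move=> /closed_rootP[t /rootP tr]; exists (q + t *: r); last by rewrite -line_eval.
  apply: (@det3_indep _ _ r); suff -> : det3 p (q + t *: r) r = det3 p q r by [].
  by rewrite /det3 !dotE !row3E !mxE; ring.
exists r.
  apply: (@det3_indep _ _ (- q)); suff -> : det3 p r (- q) = det3 p q r by [].
  by rewrite /det3 !dotE !row3E !mxE; ring.
have lrq : line r q f = c *: 'X^(d.+1).
  apply: (poly_eq_nz char0) => s s0.
  by rewrite (line_swap _ _ fh s0) E hornerC hornerZ hornerXn mulrC.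
have := congr1 (fun P : {poly k} => P.[0]) lrq.
by rewrite line_eval scale0r addr0 => ->; rewrite hornerZ hornerXn expr0n mulr0.
Qed.

Lemma indeg_neq0 e : is_indeg (syz f) e -> (0 < e)%N.
Proof.
move=> [[s [sS sh] s0] _]; rewrite lt0n; apply/eqP => e0; rewrite e0 in sh.
pose p : 'rV[k]_3 := \row_i (s 0 i)@_0%MM.
have sE i : s 0 i = (p 0 i)%:MP by rewrite mxE -pihomog0E pihomog_dE.
apply: (@irreducible_not_cone p).
  apply: contraNneq s0 => p0; apply/eqP/rowP => i.
  by rewrite sE p0 !mxE mpolyC0.
move=> v; have /syzP := sS; move/(congr1 (meval (v 0))); rewrite meval0 => E0; rewrite -[RHS]E0.
rewrite /dot raddf_sum; apply: eq_bigr => i _ /=.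
by rewrite mevalM sE mevalC gradE.
Qed.

Lemma homog1_eval (g : R) v : g \is 1.-homog ->
  g.@[v 0] = \sum_j v 0 j * g@_U_(j)%MM.
Proof.
move=> gh; have := euler_eval v gh; rewrite mul1r => <-.
apply: eq_bigr => j _; congr (_ * _).
have dh : g^`M(j) \is 0.-homog by apply: mderiv_homog.
by rewrite -(pihomog_dE dh) pihomog0E mevalC mcoeff_deriv mnm0E mulr1n add0m.
Qed.

(* Evaluating cross eps eta = c grad f where eps vanishes shows that f is
   singular there. *)
Lemma free_indeg_neq1 e : (2 <= d)%N -> prime_elt f -> free_divisor f ->
  is_indeg (syz f) e -> e != 1%N.
Proof.
move=> d2 fP ffree ind; apply/eqP => e1; rewrite e1 in ind.
have f0 : f != 0 by case: fI.
have [[eps epsS eps0] _] := ind.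
have [eta [c [_ c0 E]]] := free_syz_eta char0 f0 fh fP ffree ind epsS eps0.
have [epsK epsh] := epsS.
pose A : 'M[k]_3 := \matrix_(j, i) (eps 0 i)@_U_(j)%MM.
have epsE v i : (eps 0 i).@[v 0] = (v *m A) 0 i.
  by rewrite homog1_eval // !mxE; apply: eq_bigr => j _; rewrite mxE.
have fA : kills A f.
  move=> v; have /syzP := epsK; move/(congr1 (meval (v 0))); rewrite meval0 => E0; rewrite -[RHS]E0.
  rewrite /dot raddf_sum; apply: eq_bigr => i _ /=.
  by rewrite mevalM epsE gradE.
have fix0 (p : 'rV[k]_3) lam : p != 0 -> p *m A = lam *: p -> f.@[p 0] = 0.
  move=> p0 pA; have eul := euler_eval p fh.
  suff : d.+1%:R * f.@[p 0] = 0.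
    by move/eqP; rewrite mulf_eq0 (negbTE (natr_neq0 char0 d)) => /eqP.
  have [l0|l0] := eqVneq lam 0; last first.
    have : lam * (d.+1%:R * f.@[p 0]) = 0.
      rewrite -eul mulr_sumr -[RHS](fA p) pA; apply: eq_bigr => i _.
      by rewrite mxE mulrA.
    by move/eqP; rewrite mulf_eq0 (negbTE l0) => /eqP.
  have ep i : (eps 0 i).@[p 0] = 0 by rewrite epsE pA l0 scale0r mxE.
  rewrite -eul big1 // => i _; rewrite -gradE.
  suff : c * (grad f 0 i).@[p 0] = 0.
    by move/eqP; rewrite mulf_eq0 (negbTE c0) => /eqP ->; rewrite mulr0.
  have := congr1 (fun w : 'rV[R]_3 => (w 0 i).@[p 0]) E.
  rewrite [in X in _ = X]mxE mevalM mevalC => E1; rewrite -E1 {E1}.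
  by move: i; apply: forall_ord3; rewrite row3E mevalB !mevalM !ep !mul0r subr0.
have n2 : (2 <= d.+1)%N by rewrite ltnS.
have [p [q [r [p0 pA qA rA]]]] := nilpotent_chain char0 fI fh n2 fA fix0.
have [pq D0] := chain_det3_neq0 p0 pA qA rA.
have [cc cE] := exists_parabola char0 fI fh fA pq pA qA rA n2.
have [g [g0 gh gf]] := parabola_conic_divides char0 fh pq D0 (ltn0Sn d) cE.
by have := irreducible_homog_factor fI fh g0 gh gf; move: d2; case: (d) => [|[|]].
Qed.

End LowDegree.

(** * Linear nonzerodivisors *)

Definition coprime_elts (A : idomainType) (g h : A) : Prop :=
  forall p, prime_elt p -> divides p g -> divides p h -> False.

Definition nonzerodivisor_mod2 (A : idomainType) (g h l : A) : Prop :=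
  forall p, in_ideal2 g h (l * p) -> in_ideal2 g h p.

(** * Coprime pairs of univariate polynomials over a factorial domain *)

Section PolyCoprime.
Variable A : idomainType.
Hypothesis fA : factorial_ring A.
Implicit Types (g h r p q : {poly A}).

Lemma positive_degree_prime r : (1 < size r)%N ->
  exists p, [/\ prime_elt p, divides p r & (1 < size p)%N].
Proof.
move=> sr; have r0 : r != 0 by rewrite -size_poly_gt0 (ltnW sr).
have [c [r1 [c0 rE r1prim]]] := content_primitive fA r0.
have r10 : r1 != 0 by apply: contraNneq r0 => r10; rewrite rE r10 mulr0.
have sr1 : size r = size r1 by rewrite rE mul_polyC size_scale.
have [|p pP pr1] := exists_prime_divisor (factorial_poly fA) r10.
  by rewrite poly_unitE -sr1 gtn_eqF.
exists p; split=> //; first by rewrite rE; apply: divides_mull.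
rewrite ltnNge; apply/negP => sp; have [p0 pU _] := pP.
have pE := size1_polyC sp.
have c0' : p`_0 != 0 by apply: contraNneq p0 => E; rewrite pE E.
have cU : p`_0 \isn't a GRing.unit by apply: contra pU => cU; rewrite pE rmorph_unit.
have [q qP [x xE]] := exists_prime_divisor fA c0' cU.
apply: (r1prim q qP); apply: divides_trans pr1.
by rewrite pE xE polyCM; exists x%:P.
Qed.

(** [D] does the work of a resultant. If the least element of (g, h) had positive degree, so would
    one of its prime factors; that prime, dividing no nonzero constant, would divide both g and
    h. *)
Lemma coprime_bezout g h : g != 0 -> coprime_elts g h ->
  exists2 D : A, D != 0 & in_ideal2 g h D%:P.
Proof.
move=> g0 gh; have [r [r0 rI rmin]] := min_size_ideal2 h g0.
have pdiv x := min_size_pseudo_divides (x := x) r0 rI rmin.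
have [sr|sr] := leqP (size r) 1.
  exists r`_0; last by rewrite -(size1_polyC sr).
  by apply: contraNneq r0 => E; rewrite (size1_polyC sr) E.
have [p [pP pr sp]] := positive_degree_prime sr; have [p0 _ pD] := pP.
have dvd x : in_ideal2 g h x -> divides p x.
  move=> /pdiv[c [q [c0 E]]].
  have [||//] := pD c%:P x; first by rewrite E; apply: divides_mulr.
  move=> [y yE]; have y0 : y != 0 by apply: contraNneq c0 => y0; rewrite -polyC_eq0 yE y0 mulr0.
  have := size_polyC c; rewrite c0 yE size_mul // -(prednK (ltnW sp)).
  have := size_poly_gt0 y; rewrite y0; move: sp; clear; lia.
case: (gh p pP); first by apply: dvd; exists 1, 0; ring.
by apply: dvd; exists 0, 1; ring.
Qed.

(** Let D = al g + be h and l p = a g + b h. Then D b - l be p lies in (g). Division by g, whose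
    leading coefficient is a unit, turns this into D (b mod g) = l (be p mod g), both sides being
    smaller than g. So l divides b mod g, and p - r2 h becomes a multiple of g after cancelling l,
    which does not divide g. *)
Lemma coprime_nonzerodivisor g h (D l : A) : lead_coef g \is a GRing.unit ->
  in_ideal2 g h D%:P -> prime_elt l -> ~ divides l D ->
  nonzerodivisor_mod2 g h l%:P.
Proof.
move=> gU [al [be DE]] lP lD p [a [b pE]].
have lP' := prime_polyC lP; have [l0 _ lprime] := lP'.
have lD' : ~ divides l%:P D%:P.
  move=> [c cE]; apply: lD; exists c`_0.
  by have := congr1 (fun q : {poly A} => q`_0) cE; rewrite coefC coefCM.
have g0 : g != 0 by apply: contraTneq gU => ->; rewrite lead_coef0 unitr0.
have divg x := Pdiv.IdomainUnit.divp_eq gU x.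
have smod x : (size (x %% g)%R < size g)%N by rewrite Pdiv.Idomain.ltn_modp.
pose u := be * p.
have DbE : D%:P * (b %% g) - l%:P * (u %% g) =
    g * (al * b - be * a - D%:P * (b %/ g) + l%:P * (u %/ g)).
  have bE : b %% g = b - (b %/ g) * g by rewrite [in X in X - _](divg b); ring.
  have uE : u %% g = u - (u %/ g) * g by rewrite [in X in X - _](divg u); ring.
  rewrite bE uE.
  transitivity (D%:P * b - be * (l%:P * p)
    + g * (- D%:P * (b %/ g) + l%:P * (u %/ g))); first by rewrite /u; ring.
  by rewrite pE DE; ring.
have E0 : D%:P * (b %% g) = l%:P * (u %% g).
  apply/eqP; rewrite -subr_eq0.
  have sX : (size (D%:P * (b %% g) - l%:P * (u %% g))%R < size g)%N.
    have sc (c : A) (x : {poly A}) : (size x < size g)%N -> (size (c%:P * x)%R < size g)%N.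
      by apply: leq_ltn_trans; rewrite mul_polyC size_scale_leq.
    rewrite (leq_ltn_trans (size_polyD _ _)) // size_polyN gtn_max.
    by rewrite !sc.
  move: sX; rewrite DbE; move: (_ + l%:P * _) => Y.
  have [->|Y0] := eqVneq Y 0; first by rewrite mulr0.
  rewrite size_mul // => sX; exfalso; have := Y0; rewrite -size_poly_gt0.
  by move: sX; move: (size g) (size Y) => i j; clear; lia.
have [||[r2 rE]] := lprime D%:P (b %% g) => //.
  by rewrite E0; exists (u %% g).
have E1 : l%:P * (p - r2 * h) = g * (a + (b %/ g) * h).
  rewrite mulrBr pE {1}(divg b) rE; ring.
have lg : ~ divides l%:P g.
  move=> [c cE]; case: lP => _ /negP lU _; apply: lU.
  by have := gU; rewrite cE lead_coefM lead_coefC unitrM => /andP[].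
have [||[c cE]] := lprime g (a + (b %/ g) * h) => //.
  by rewrite -E1; exists (p - r2 * h).
exists c, r2; apply: (mulfI l0); apply/eqP; rewrite -subr_eq0; apply/eqP.
transitivity (l%:P * (p - r2 * h) - g * (l%:P * c)); first by ring.
by rewrite E1 cE subrr.
Qed.

End PolyCoprime.

(** * Passage to general coordinates *)

Section Shear.
Variable k : fieldType.
Hypothesis char0 : [pchar k] =i pred0.

Lemma coef_muni_homog n d (p : {mpoly k[n.+1]}) j : p \is d.-homog ->
  if (j <= d)%N then (muni p)`_j \is (d - j).-homog else (muni p)`_j == 0.
Proof.
move=> /dhomogP ph; rewrite muniE coef_sum.
have term m : m \in msupp p -> (p@_m *: 'X_[[multinom m (widen_ord (leqnSn n) i) | i < n]] *: 'X^(m ord_max))`_j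
   = if j == m ord_max then p@_m *: 'X_[[multinom m (widen_ord (leqnSn n) i) | i < n]] else 0.
  by move=> _; rewrite coefZ coefXn; case: eqP; rewrite ?mulr1 ?mulr0.
have degm m : m \in msupp p -> (mdeg [multinom m (widen_ord (leqnSn n) i) | i < n] + m ord_max = d)%N.
  move=> /ph mp; have {}mp : mdeg m = d := mp.
  rewrite -mp !mdegE big_ord_recr /=; congr (_ + _)%N.
  by apply: eq_bigr => i _; rewrite mnmE.
rewrite big_seq (eq_bigr _ term) -big_seq.
case: leqP => jd.
  rewrite big_seq; apply: rpred_sum => m mp; case: eqP => [jm|_]; last exact: rpred0.
  apply: rpredZ; rewrite dhomogX; apply/eqP; rewrite -(degm m mp) jm addnK.
  by [].
rewrite big_seq big1 // => m mp; case: eqP => // jm.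
by move: jd; rewrite jm -(degm m mp) ltnNge leq_addl.
Qed.

Lemma lead_coef_muni d (p : {mpoly k[3]}) : p \is d.-homog ->
  (muni p)`_d@_0%MM != 0 -> lead_coef (muni p) \is a GRing.unit.
Proof.
move=> ph c0.
have sp : size (muni p) = d.+1.
  apply/eqP; rewrite eqn_leq; apply/andP; split.
    by apply/leq_sizeP => j dj; have := coef_muni_homog j ph; rewrite leqNgt dj => /eqP.
  by rewrite ltnNge; apply: contra c0 => /leq_sizeP -> //; rewrite mcoeff0.
rewrite lead_coefE sp /=; have := coef_muni_homog d ph; rewrite leqnn subnn => h0.
by rewrite -(pihomog_dE h0) pihomog0E rmorph_unit // unitfE.
Qed.

Lemma substitution_homog n (psi : {rmorphism {mpoly k[n]} -> {mpoly k[n]}}) d p :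
  (forall c, psi c%:MP = c%:MP) -> (forall i, psi 'X_i \is 1.-homog) ->
  p \is d.-homog -> psi p \is d.-homog.
Proof.
move=> psiC psiX /dhomogP ph; rewrite [p]mpolyE rmorph_sum big_seq.
apply: rpred_sum => m mp; rewrite -mul_mpolyC rmorphM psiC mul_mpolyC.
apply: rpredZ; have <- : mdeg m = d := ph m mp.
rewrite mdegE.
rewrite mpolyXE_id rmorph_prod.
elim/big_rec2: _ => [|i q e _ IH]; first exact: dhomog1.
by apply: dhomogM IH; rewrite rmorphXn; have := dhomogMn (m i) (psiX i); rewrite mul1n.
Qed.

Section NonzerodivisorTransport.
Variables (A B : idomainType) (phi : {rmorphism A -> B}) (psi : {rmorphism B -> A}).
Hypotheses (phiK : cancel phi psi) (psiK : cancel psi phi).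

Lemma coprime_transport g h : coprime_elts g h -> coprime_elts (phi g) (phi h).
Proof.
move=> gh p pP [a aE] [b bE]; apply: (gh (psi p)); first exact: prime_transport phiK psiK _ pP.
  by exists (psi a); rewrite -rmorphM -aE phiK.
by exists (psi b); rewrite -rmorphM -bE phiK.
Qed.

Lemma nonzerodivisor_transport g h l :
  nonzerodivisor_mod2 (phi g) (phi h) l -> nonzerodivisor_mod2 g h (psi l).
Proof.
move=> H p [a [b E]]; have [|c [c' E']] := H (phi p).
  by exists (phi a), (phi b); rewrite -!rmorphM -rmorphD -E rmorphM psiK.
by exists (psi c), (psi c'); rewrite -[p]phiK E' rmorphD !rmorphM !phiK.
Qed.
End NonzerodivisorTransport.

(** A shear carries (0,0,1) to a multiple of a point u with g(u) and u_2 nonzero; then g has a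
    constant leading coefficient in the last variable. Bezout gives a nonzero D in the other two
    variables, and any linear form in these that does not divide D will do. *)
Lemma exists_linear_nonzerodivisor d (g h : {mpoly k[3]}) :
  g != 0 -> g \is d.-homog -> coprime_elts g h ->
  exists l, [/\ l != 0, l \is 1.-homog & nonzerodivisor_mod2 g h l].
Proof.
move=> g0 gh cop.
have [u u2 gu] : exists2 u : 'I_3 -> k, u o2 != 0 & g.@[u] != 0.
  apply: NNPP => H; have : 'X_o2 * g != 0.
    by rewrite mulf_neq0 // -msize_poly_eq0 msizeX.
  move/eqP; apply; apply: (meval_eq0 char0) => u; rewrite mevalM mevalXU.
  apply/eqP/negPn/negP; rewrite mulf_eq0 negb_or => /andP[nz1 nz2].
  by apply: H; exists u.
pose w i := if i == o2 then 0 else u i / u o2.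
have [sg [sgC sgX]] := substitution (fun i : 'I_3 => 'X_i + w i *: 'X_o2 : {mpoly k[3]}).
have [ta [taC taX]] := substitution (fun i : 'I_3 => 'X_i - w i *: 'X_o2 : {mpoly k[3]}).
have w2 : w o2 = 0 by [].
have sg2 : sg 'X_o2 = 'X_o2 by rewrite sgX w2 scale0r addr0.
have ta2 : ta 'X_o2 = 'X_o2 by rewrite taX w2 scale0r subr0.
have sgK : cancel sg ta.
  apply: (@mpoly_rmorph_ext _ _ _ (ta \o sg) idfun) => [c|i] /=; first by rewrite sgC taC.
  by rewrite sgX rmorphD taX -mul_mpolyC rmorphM taC ta2 mul_mpolyC subrK.
have taK : cancel ta sg.
  apply: (@mpoly_rmorph_ext _ _ _ (sg \o ta) idfun) => [c|i] /=; first by rewrite taC sgC.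
  by rewrite taX rmorphB sgX -mul_mpolyC rmorphM sgC sg2 mul_mpolyC addrK.
have Xh i : ('X_i : {mpoly k[3]}) \is 1.-homog by rewrite dhomogX /= mdeg1.
have sgh : sg g \is d.-homog.
  by apply: substitution_homog => // i; rewrite sgX rpredD ?rpredZ.
pose phi : {rmorphism {mpoly k[3]} -> {poly {mpoly k[2]}}} := @muni 2 k \o sg.
pose psi : {rmorphism {poly {mpoly k[2]}} -> {mpoly k[3]}} := ta \o @muni_inv k 2.
have phiK : cancel phi psi by move=> p; rewrite /= muniK sgK.
have psiK : cancel psi phi by move=> p; rewrite /= taK muni_invK.
have gU : lead_coef (phi g) \is a GRing.unit.
  apply: (lead_coef_muni sgh); apply: contraNneq gu => c0.
  pose v (i : 'I_3) : k := (i == o2)%:R.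
  have E : (sg g).@[v] = u o2 ^- d * g.@[u].
    have -> : u o2 ^- d * g.@[u] = (u o2)^-1 ^+ d * g.@[u] by rewrite exprVn.
    rewrite -(meval_scale_homog _ _ gh).
    apply: (@mpoly_rmorph_ext _ _ _ (meval v \o sg) (meval _)) => [c|i] /=.
      by rewrite sgC !mevalC.
    rewrite sgX mevalD mevalZ !mevalXU /v /w.
    have [->|_] := eqVneq; first by rewrite mul0r addr0 mulVf.
    by rewrite add0r eqxx mulr1 mulrC.
  have E0 : (sg g).@[v] = 0.
    rewrite meval_muni horner_coef big1 // => j _; rewrite coef_map.
    suff E1 : ((muni (sg g))`_j).@[v \o widen_ord (leqnSn 2)] = 0.
      by apply/eqP; rewrite mulf_eq0; apply/orP; left; apply/eqP; exact: E1.
    have := coef_muni_homog j sgh; case: ltngtP => [jd|_ /eqP ->|jd]; last 1 first.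
    - by rewrite jd subnn => H; rewrite -(pihomog_dE H) pihomog0E c0 mevalC.
    - move=> H; rewrite (@meval_eq _ _ _ (fun i => 0 * (v \o widen_ord (leqnSn 2)) i)).
        by rewrite (meval_scale_homog _ _ H) expr0n subn_eq0 leqNgt jd mul0r.
      move=> i; rewrite mul0r /v /=; case: eqP => // /(congr1 val) /= E'.
      by have := ltn_ord i; rewrite E'.
    - by rewrite meval0.
  by move: E; rewrite E0 => /esym/eqP; rewrite mulf_eq0 invr_eq0 expf_eq0 (negbTE u2) andbF.
have g0' : phi g != 0 by apply: contraTneq gU => ->; rewrite lead_coef0 unitr0.
have [D D0 DI] := coprime_bezout (@factorial_mpoly k 2) g0' (coprime_transport phiK psiK cop).
pose j0 : 'I_2 := ord0; pose j1 : 'I_2 := lift ord0 ord0.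
have [x x0 Dx] : exists2 x : 'I_2 -> k, x j0 != 0 & D.@[x] != 0.
  apply: NNPP => H; have : 'X_j0 * D != 0.
    by rewrite mulf_neq0 // -msize_poly_eq0 msizeX.
  move/eqP; apply; apply: (meval_eq0 char0) => x; rewrite mevalM mevalXU.
  apply/eqP/negPn/negP; rewrite mulf_eq0 negb_or => /andP[nz1 nz2].
  by apply: H; exists x.
(* This form vanishes at [x], where [D] does not; it is nonzero because [x j0] is. *)
pose l : {mpoly k[2]} := x j1 *: 'X_j0 - x j0 *: 'X_j1.
have lh : l \is 1.-homog by rewrite rpredB ?rpredZ // dhomogX /= mdeg1.
have l0 : l != 0.
  apply: contraNneq x0 => l0; have := congr1 (meval (fun i => (i == j1)%:R)) l0.
  by rewrite mevalB !mevalZ !mevalXU meval0 eqxx /= mulr0 mulr1 sub0r => /eqP; rewrite oppr_eq0.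
have lD : ~ divides l D.
  move=> [c cE]; move: Dx; rewrite cE mevalM /l mevalB !mevalZ !mevalXU.
  by rewrite [x j1 * _]mulrC subrr mul0r eqxx.
exists (psi l%:P); split.
- apply: contraNneq l0 => /(congr1 phi); rewrite psiK rmorph0 => /eqP.
  by rewrite polyC_eq0.
- rewrite /= muni_invC /l mwidenB !mwidenZ !mwidenX !mnmwiden1.
  apply: (substitution_homog taC) => [i|]; first by rewrite taX rpredB ?rpredZ.
  by rewrite rpredB ?rpredZ.
- apply: nonzerodivisor_transport phiK psiK _ _ _ _.
  exact: coprime_nonzerodivisor gU DI (homog1_prime l0 lh) lD.
Qed.

End Shear.

(** * The Hilbert function when e = d *)

Section Dimension.
Variables (k : fieldType) (V U W : vectType k).
Variables (iota : {linear V -> U}) (theta : {linear U -> W}).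

(** This and [dim_surjective_ge] are the two halves of rank-nullity for V -> U -> W, separated
    because each dimension count below uses one half. *)
Lemma dim_kernel_le :
  (forall u, theta u = 0 -> exists v, u = iota v) ->
  (dim U <= dim V + dim W)%N.
Proof.
move=> ker; rewrite -!dimvf -(limg_ker_dim (linfun theta) fullv) leq_add //.
  have : (fullv :&: lker (linfun theta) <= limg (linfun iota))%VS.
    apply/subvP => u; rewrite memv_cap memvf memv_ker lfunE /= => /eqP /ker[v ->].
    by rewrite -(lfunE iota) memv_img ?memvf.
  move/dimvS/leq_trans; apply.
  by rewrite -[X in (_ <= X)%N](limg_ker_dim (linfun iota)) leq_addl.
exact/dimvS/subvf.
Qed.

Lemma dim_surjective_ge :
  (forall w, exists u, w = theta u) -> (forall v, theta (iota v) = 0) ->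
  (forall v, iota v = 0 -> v = 0) -> (dim V + dim W <= dim U)%N.
Proof.
move=> surj comp0 inj; rewrite -!dimvf -(limg_ker_dim (linfun theta) fullv) leq_add //.
  rewrite -(@limg_dim_eq _ _ _ (linfun iota) fullv).
    apply: dimvS; apply/subvP => u /memv_imgP[v _ ->].
    by rewrite memv_cap memvf memv_ker !lfunE /= comp0.
  apply/eqP; rewrite -subv0; apply/subvP => v.
  by rewrite memv_cap memv_ker lfunE memv0 => /andP[_ /eqP /inj ->].
apply: dimvS; apply/subvP => w _; have [u ->] := surj w.
by rewrite -(lfunE theta) memv_img ?memvf.
Qed.

End Dimension.

(** * The Hilbert function of R/I and the dimension of Syz_n *)

Section HilbertBound.
Variable k : fieldType.
Local Notation R := {mpoly k[3]}.
Local Notation V n := (dhomog 3 k n).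
Local Notation N n := ('C(n + 2, n)).
Variables (f : R) (d : nat).
Hypothesis fh : f \is d.+1.-homog.

Definition to_homog n (p : R) : V n := DHomog (pihomogP mdeg n p).

Lemma to_homog_is_linear n : linear (@to_homog n).
Proof. by move=> a p q; apply: val_inj; rewrite /= linearP. Qed.
HB.instance Definition _ n :=
  GRing.isLinear.Build k R (V n) _ (@to_homog n) (@to_homog_is_linear n).

Lemma to_homogE n (p : R) : p \is n.-homog -> val (to_homog n p) = p.
Proof. by move=> ph /=; rewrite pihomog_dE. Qed.

(** Dimension counts need finite-dimensional spaces over k, so syzygies of a fixed degree are
    encoded as triples of forms. *)
Definition vec n (s : V n * V n * V n) : 'rV[R]_3 :=
  row3 (val s.1.1) (val s.1.2) (val s.2).

Lemma vec_lin n (a : k) (s t : V n * V n * V n) :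
  vec (a *: s + t) = a%:MP *: vec s + vec t.
Proof. by apply: rowP3; rewrite !mxE /= ?mul_mpolyC. Qed.

Lemma vec_homog n (s : V n * V n * V n) i : vec s 0 i \is n.-homog.
Proof. by move: i; apply: forall_ord3; rewrite row3E; apply: dhomog_is_dhomog. Qed.

Definition unvec n (v : 'rV[R]_3) : V n * V n * V n :=
  (to_homog n (v 0 o0), to_homog n (v 0 o1), to_homog n (v 0 o2)).

Lemma vecK n (v : 'rV[R]_3) : (forall i, v 0 i \is n.-homog) -> vec (unvec n v) = v.
Proof. by move=> vh; apply: rowP3; rewrite row3E /= pihomog_dE. Qed.

Lemma unvecK n (s : V n * V n * V n) : unvec n (vec s) = s.
Proof.
case: s => [[s0 s1] s2]; rewrite /unvec /vec !row3E /=.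
by congr (_, _, _); apply: val_inj; apply: to_homogE; apply: dhomog_is_dhomog.
Qed.

Lemma unvec_lin n (a : k) (s t : 'rV[R]_3) :
  unvec n (a%:MP *: s + t) = a *: unvec n s + unvec n t.
Proof. by rewrite /unvec !mxE !mul_mpolyC !linearP. Qed.

Definition syz_map n (s : V n * V n * V n) : V (d + n) :=
  to_homog (d + n) (dot (vec s) (grad f)).

Lemma dot_lin (a : R) (s t F : 'rV[R]_3) : dot (a *: s + t) F = a * dot s F + dot t F.
Proof. by rewrite !dotE !mxE; ring. Qed.

Lemma syz_map_is_linear n : linear (@syz_map n).
Proof. by move=> a s t; rewrite /syz_map vec_lin dot_lin mul_mpolyC linearP. Qed.
HB.instance Definition _ n := GRing.isLinear.Build k _ _ _ (@syz_map n) (@syz_map_is_linear n).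

Definition syz_space n : {vspace V n * V n * V n} := lker (linfun (@syz_map n)).

Lemma syz_spaceP n (s : V n * V n * V n) : (s \in syz_space n) = (vec s \in syz f).
Proof.
rewrite memv_ker lfunE /=; apply/eqP/syzP => E; last first.
  by apply: val_inj; rewrite /syz_map E linear0.
move/(congr1 val): E => /=; rewrite pihomog_dE //.
apply: rpred_sum => i _; rewrite addnC; apply: dhomogM; first exact: vec_homog.
exact: grad_homog.
Qed.

(** Syz_n is the kernel of a map from R_n^3 to R_(d+n); this inequality yields the upper bound
    d^2. *)
Lemma dim_syz_space n : (3 * N n <= \dim (syz_space n) + N (d + n))%N.
Proof.
have := limg_ker_dim (linfun (@syz_map n)) fullv; rewrite capfv dimvf.
have -> : dim (V n * V n * V n)%type = (3 * N n)%N by rewrite /dim /= mulSn mul2n -addnn addnA.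
move=> <-; rewrite leq_add2l -[X in (_ <= X)%N](dimvf (V (d + n))).
exact/dimvS/subvf.
Qed.

Definition multiples n (eps : 'rV[R]_3) (g : V n) : subvs_of (syz_space (n + d)) :=
  vsproj _ (unvec (n + d) (val g *: eps)).

Lemma multiples_is_linear n eps : linear (@multiples n eps).
Proof.
move=> a p q; rewrite /multiples -linearP; congr vsproj.
rewrite -unvec_lin /=; congr unvec.
by rewrite scalerDl -mul_mpolyC -scalerA.
Qed.
HB.instance Definition _ n eps :=
  GRing.isLinear.Build k _ _ _ (@multiples n eps) (@multiples_is_linear n eps).

Lemma multiplesE n eps (g : V n) : graded_piece (syz f) d eps ->
  vec (vsval (multiples eps g)) = val g *: eps.
Proof.
move=> [epsS epsh].
have gh i : (val g *: eps) 0 i \is (n + d).-homog.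
  by rewrite mxE; apply: dhomogM; [apply: dhomog_is_dhomog|apply: epsh].
rewrite /multiples vsprojK ?vecK // syz_spaceP vecK //.
have := syz_lin_comb (val g) 0 epsS epsS.
by rewrite scale0r addr0.
Qed.

Lemma multiples_component n eps (g : R) (u : subvs_of (syz_space (n + d))) :
  graded_piece (syz f) d eps -> vec (vsval u) = g *: eps ->
  u = multiples eps (to_homog n g).
Proof.
move=> epsS uE; apply: val_inj; rewrite -[LHS]unvecK -[RHS]unvecK; congr unvec.
apply: etrans (esym (multiplesE _ epsS)); rewrite -(component_id (vec_homog (vsval u))) uE.
apply/rowP => i; rewrite !mxE addnC mulrC pihomogMl; last exact: epsS.2.
by rewrite mulrC.
Qed.

Lemma multiples_inj n eps (g : V n) : graded_piece (syz f) d eps -> eps != 0 ->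
  multiples eps g = 0 -> g = 0.
Proof.
move=> epsS eps0 E; apply: val_inj => /=; have := multiplesE g epsS; rewrite E.
have [i ei] := exists_coord_neq0 eps0 => /(congr1 (fun v : 'rV[R]_3 => v 0 i)).
rewrite linear0 [in RHS]mxE => /esym E0.
apply/eqP; have : val g * eps 0 i == 0.
  by rewrite E0 /vec; move: (i); apply: forall_ord3; rewrite row3E.
by rewrite mulf_eq0 (negbTE ei) orbF.
Qed.

Section UpperIdeal.
Variables (eps : 'rV[R]_3) (I : {pred R}) (phi : 'rV[R]_3 -> R).
Hypotheses (epsS : graded_piece (syz f) d eps) (eps0 : eps != 0).
Hypothesis phiL : forall (c : R) (s t : 'rV[R]_3), s \in syz f -> t \in syz f ->
  phi (c *: s + t) = c * phi s + phi t.
Hypothesis phiK : forall s, s \in syz f -> (phi s = 0 <-> exists c : R, s = c *: eps).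
Hypothesis phiI : forall p : R, p \in I <-> exists2 s, s \in syz f & phi s = p.
Hypothesis phiH : forall n s, graded_piece (syz f) n s -> phi s \is n.-homog.

Lemma syz0 : 0 \in syz f.
Proof. by have := syz_lin_comb 0 0 epsS.1 epsS.1; rewrite !scale0r addr0. Qed.

Lemma phi0 : phi 0 = 0.
Proof. by apply/phiK; [exact: syz0|exists 0; rewrite scale0r]. Qed.

Lemma phiD s t : s \in syz f -> t \in syz f -> phi (s + t) = phi s + phi t.
Proof. by move=> sS tS; rewrite -[s in LHS]scale1r phiL // mul1r. Qed.

Lemma component_sum (s : 'rV[R]_3) : exists K, s = \sum_(j < K) component j s.
Proof.
pose K := (\sum_(i < 3) msize (s 0 i)%R)%N; exists K; apply/rowP => i; rewrite summxE.
have le : (msize (s 0 i)%R <= K)%N by rewrite /K (bigD1 i) //= leq_addr.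
rewrite {1}(pihomog_partitionE le).
by apply: eq_bigr => j _; rewrite mxE.
Qed.

Lemma phi_component n s : s \in syz f -> phi (component n s) = pihomog mdeg n (phi s).
Proof.
move=> sS; have [K sE] := component_sum s.
have compS j : component j s \in syz f := (component_syz fh j sS).1.
have comp_homog j : phi (component j s) \is j.-homog := phiH (component_syz fh j sS).
have [sumS sumE] : \sum_(j < K) component j s \in syz f /\
    phi (\sum_(j < K) component j s) = \sum_(j < K) phi (component j s).
  elim: (K) => [|m [IHS IH]]; first by rewrite !big_ord0 phi0; split; first exact: syz0.
  rewrite !big_ord_recr /= phiD // IH; split=> //.
  by have := syz_lin_comb 1 1 IHS (compS m); rewrite !scale1r.
rewrite {2}sE sumE linear_sum /=.
have [nK|Kn] := ltnP n K.
  rewrite (bigD1 (Ordinal nK)) //= pihomog_dE // big1 ?addr0 // => j jn.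
  by apply: pihomog_ne0 (comp_homog j); rewrite -val_eqE in jn.
rewrite big1 => [|j _]; last first.
  by apply: pihomog_ne0 (comp_homog j); rewrite neq_ltn (leq_trans (ltn_ord j) Kn).
suff -> : component n s = 0 by rewrite phi0.
apply/rowP => i; rewrite mxE [RHS]mxE.
rewrite [s 0 i](congr1 (fun v : 'rV[R]_3 => v 0 i) sE) summxE linear_sum big1 // => j _.
rewrite [component j s 0 i]mxE; apply: pihomog_ne0 (pihomogP _ _ _).
by rewrite neq_ltn (leq_trans (ltn_ord j) Kn).
Qed.

Variables (n h : nat) (b : 'I_h -> R).
Hypothesis bh : forall i, b i \is (n + d).-homog.
Hypothesis bfree : forall c : 'I_h -> k, \sum_(i < h) c i *: b i \in I -> forall i, c i = 0.
Hypothesis bgen : forall p : R, p \is (n + d).-homog ->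
  exists c : 'I_h -> k, p - \sum_(i < h) c i *: b i \in I.

(** With h = dim (R/I)_(n+d), this map and [multiples0] form 0 -> R_n -> Syz_(n+d) + k^h -> R_(n+d)
    -> 0. Independence of the [b i] modulo I gives exactness in the middle, generation gives
    surjectivity. *)
Definition theta_poly (x : subvs_of (syz_space (n + d)) * 'rV[k]_h) : R :=
  phi (vec (vsval x.1)) + \sum_i x.2 0 i *: b i.

Definition theta x : V (n + d) := to_homog (n + d) (theta_poly x).

Lemma vec_syz (u : subvs_of (syz_space (n + d))) : vec (vsval u) \in syz f.
Proof. by rewrite -syz_spaceP subvsP. Qed.

Lemma theta_is_linear : linear theta.
Proof.
move=> a x y; apply: etrans (linearP _ a (theta_poly x) (theta_poly y)).
apply: (congr1 (@to_homog (n + d))); rewrite /theta_poly.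
have -> : vsval (a *: x + y).1 = a *: vsval x.1 + vsval y.1 by [].
rewrite vec_lin phiL ?vec_syz // mul_mpolyC scalerDr addrACA; congr (_ + _).
by rewrite scaler_sumr -big_split; apply: eq_bigr => i _; rewrite !mxE scalerDl scalerA.
Qed.
HB.instance Definition _ := GRing.isLinear.Build k _ _ _ theta theta_is_linear.

Definition multiples0 (g : V n) : subvs_of (syz_space (n + d)) * 'rV[k]_h :=
  (multiples eps g, 0).

Lemma multiples0_is_linear : linear multiples0.
Proof.
move=> a p q; rewrite /multiples0 linearP.
by apply: (congr2 pair) => //=; rewrite scaler0 addr0.
Qed.
HB.instance Definition _ := GRing.isLinear.Build k _ _ _ multiples0 multiples0_is_linear.

Lemma dim_prod_row : dim (subvs_of (syz_space (n + d)) * 'rV[k]_h)%type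
  = (\dim (syz_space (n + d)) + h)%N.
Proof. by apply: (congr2 addn) => //; apply: mul1n. Qed.

Lemma theta_homog x : theta_poly x \is (n + d).-homog.
Proof.
apply: rpredD; first by apply: phiH; split; [exact: vec_syz|exact: vec_homog].
by apply: rpred_sum => i _; apply: rpredZ; apply: bh.
Qed.

Lemma hilbert_value_le : (\dim (syz_space (n + d)) + h <= N n + N (n + d))%N.
Proof.
rewrite -dim_prod_row.
apply: (@dim_kernel_le k (V n) _ (V (n + d)) multiples0 theta) => -[u c] E.
have {}E : phi (vec (vsval u)) + \sum_i c 0 i *: b i = 0.
  by have := congr1 val E; rewrite /= pihomog_dE //; apply: (theta_homog (u, c)).
have c0 i : c 0 i = 0.
  apply: (bfree (c := fun i => c 0 i)); apply/phiI; exists (- vec (vsval u)).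
    by have := syz_lin_comb (-1) 0 (vec_syz u) (vec_syz u); rewrite scale0r addr0 scaleN1r.
  have := phiL (-1) (vec_syz u) syz0; rewrite addr0 scaleN1r phi0 addr0 mulN1r => ->.
  by apply/eqP; rewrite eq_sym -subr_eq0 opprK addrC E.
have [g gE] : exists g, vec (vsval u) = g *: eps.
  apply/(phiK (vec_syz u)); rewrite -[LHS]addr0 -[RHS]E; congr (_ + _).
  by rewrite big1 // => i _; rewrite c0 scale0r.
exists (to_homog n g); rewrite /= /multiples0 (multiples_component epsS gE).
by congr pair; apply/rowP => i; rewrite c0 mxE.
Qed.

Lemma hilbert_value_ge : (N n + N (n + d) <= \dim (syz_space (n + d)) + h)%N.
Proof.
rewrite -dim_prod_row.
apply: (@dim_surjective_ge k (V n) _ (V (n + d)) multiples0 theta) => [w|g|g].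
- have [c /phiI[s sS sE]] := bgen (dhomog_is_dhomog w).
  have compS := component_syz fh (n + d) sS.
  have vE : vec (unvec (n + d) (component (n + d) s)) = component (n + d) s.
    exact: vecK compS.2.
  have [u uE] : exists u : subvs_of (syz_space (n + d)), vec (vsval u) = component (n + d) s.
    exists (vsproj _ (unvec (n + d) (component (n + d) s))).
    by rewrite vsprojK // syz_spaceP vE; exact: compS.1.
  exists (u, \row_i c i); apply: val_inj; apply: etrans (esym (pihomog_dE (theta_homog _))).
  rewrite /theta_poly [(u, _).1]/= uE phi_component // sE.
  have -> : \sum_i (u, \row_i c i).2 0 i *: b i = \sum_i c i *: b i.
    by apply: eq_bigr => i _; rewrite mxE.
  have bsum : \sum_i c i *: b i \is (n + d).-homog.
    by apply: rpred_sum => i _; apply: rpredZ; apply: bh.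
  rewrite pihomogB [pihomog _ _ (\sum_i _)]pihomog_dE // subrK.
  by rewrite pihomog_dE // dhomog_is_dhomog.
- apply: val_inj; apply: etrans (pihomog_dE (theta_homog _)) _; rewrite /theta_poly.
  rewrite [(multiples0 g).1]/= (multiplesE _ epsS) (_ : phi _ = 0); last first.
    by apply/phiK; [have := syz_lin_comb (val g) 0 epsS.1 epsS.1; rewrite scale0r addr0|exists (val g)].
  by rewrite add0r big1 ?linear0 // => i _; rewrite mxE scale0r.
- by move=> [/(multiples_inj epsS eps0)].
Qed.

End UpperIdeal.
End HilbertBound.

Lemma coprime_divides (A : idomainType) (g h x y : A) : factorial_ring A ->
  g != 0 -> coprime_elts g h -> g * x = h * y -> divides h x.
Proof.
move=> fA g0 cop E; have [u [s [uU sP gE]]] := fA g g0.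
apply: (@cancel_primes _ s h x (u^-1 * y)) => [p ps|].
  split; first exact: sP.
  move=> ph; apply: (cop p (sP p ps)) => //; rewrite gE (perm_big _ (perm_to_rem ps)).
  by rewrite big_cons; exists (u * \prod_(j <- rem p s) j); rewrite mulrCA.
by rewrite mulrCA -E gE !mulrA mulVr // mul1r.
Qed.

(** * An upper bound for the dimension of Syz_n when e = d *)

Section LowerBound.
Variable k : fieldType.
Local Notation R := {mpoly k[3]}.
Local Notation V n := (dhomog 3 k n).
Local Notation N n := ('C(n + 2, n)).
Variables (f : R) (d : nat).
Hypotheses (fh : f \is d.+1.-homog) (d1 : (1 <= d)%N).
Hypothesis low : forall n, (n < d)%N -> forall s, graded_piece (syz f) n s -> s = 0.

(** Extends minimality of d to syzygies that are not homogeneous, such as quotients of a Koszul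
    syzygy by an arbitrary factor. *)
Lemma syz_small_eq0 (s : 'rV[R]_3) : s \in syz f ->
  (forall i, (msize (s 0%R i) <= d)%N) -> s = 0.
Proof.
move=> sS ss; apply/rowP => i; rewrite [RHS]mxE (pihomog_partitionE (ss i)).
apply: big1 => j _; have := low (ltn_ord j) (component_syz fh j sS).
by move/(congr1 (fun v : 'rV[R]_3 => v 0 i)); rewrite mxE [RHS]mxE.
Qed.

Lemma grad_coord_neq0 i : grad f 0 i != 0.
Proof.
apply/eqP => E; have sS : delta_mx 0 i \in syz f.
  apply/syzP; rewrite /dot (bigD1 i) //= E mulr0 add0r big1 // => j /negbTE ji.
  by rewrite mxE ji andbF mul0r.
pose ei : 'rV[R]_3 := delta_mx 0 i.
have s_small j : (msize (ei 0%R j) <= d)%N.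
  by rewrite mxE; case: (_ && _); rewrite ?msize1 ?msize0.
have := congr1 (fun v : 'rV[R]_3 => v 0 i) (syz_small_eq0 sS s_small).
by rewrite mxE [RHS]mxE !eqxx => /eqP; rewrite oner_eq0.
Qed.

(** A common prime factor would cancel from the Koszul syzygy of f_x and f_y and leave a nonzero
    syzygy of degree below d. *)
Lemma grad01_coprime : coprime_elts (grad f 0 o0) (grad f 0 o1).
Proof.
move=> p [p0 pU _] [a aE] [b bE].
have sS : row3 b (- a) 0 \in syz f.
  by apply/syzP; rewrite dotE !row3E aE bE; ring.
have sp : (1 < msize p)%N.
  rewrite ltnNge; apply: contra pU => /msize1_polyC pE; rewrite pE.
  apply: rmorph_unit; rewrite unitfE; apply: contraNneq p0 => c0.
  by rewrite pE c0 mpolyC0.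
have small x i : grad f 0 i = p * x -> (msize x <= d)%N.
  have [->|x0] := eqVneq x 0; first by rewrite msize0.
  move=> E; have nz : grad f 0 i != 0 by rewrite E mulf_neq0.
  have := msize_homog nz (grad_homog fh i); rewrite E msizeM //.
  by move: sp; move: (mmeasure _ p) (mmeasure _ x) => i1 i2; clear; lia.
have a0 : a = 0.
  have := congr1 (fun v : 'rV[R]_3 => v 0 o1) (syz_small_eq0 sS _).
  rewrite row3E [RHS]mxE => H; apply/eqP; rewrite -oppr_eq0; apply/eqP; apply: H.
  apply: forall_ord3; rewrite row3E ?msizeN ?msize0 //; first exact: small bE.
  exact: small aE.
by have := grad_coord_neq0 o0; rewrite aE a0 mulr0 eqxx.
Qed.

Lemma syz_last0_koszul (s : 'rV[R]_3) : s \in syz f -> s 0 o2 = 0 ->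
  exists c, s = c *: koszul (grad f) o2.
Proof.
move=> /syzP; rewrite dotE => E s2; rewrite s2 mul0r addr0 in E.
have E' : grad f 0 o0 * (- s 0 o0) = grad f 0 o1 * s 0 o1.
  by apply/eqP; rewrite mulrN eq_sym -addr_eq0 addrC mulrC [_ * s 0 o1]mulrC E.
have [c cE] := coprime_divides (@factorial_mpoly k 3) (grad_coord_neq0 o0) grad01_coprime E'.
exists c; have s0E : s 0 o0 = - (grad f 0 o1 * c) by rewrite -cE opprK.
have s1E : s 0 o1 = grad f 0 o0 * c.
  by apply: (mulfI (grad_coord_neq0 o1)); rewrite -E' cE; ring.
have KE : [/\ koszul (grad f) o2 0 o0 = - grad f 0 o1, koszul (grad f) o2 0 o1 = grad f 0 o0
    & koszul (grad f) o2 0 o2 = 0].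
  move: (grad f) => F; rewrite /koszul /cross !row3E !mxE /=.
  by split; ring.
have [K0 K1 K2] := KE.
apply: rowP3; rewrite [RHS]mxE ?K0 ?K1 ?K2 ?s0E ?s1E ?s2.
- by rewrite mulrN mulrC.
- by rewrite mulrC.
- by rewrite mulr0.
Qed.

Variable l : R.
Hypotheses (l0 : l != 0) (lh : l \is 1.-homog).
Hypothesis lnz : nonzerodivisor_mod2 (grad f 0 o0) (grad f 0 o1) l.

Lemma nonzerodivisor_pow j p : in_ideal2 (grad f 0 o0) (grad f 0 o1) (l ^+ j * p) ->
  in_ideal2 (grad f 0 o0) (grad f 0 o1) p.
Proof. by elim: j => [|j IH]; rewrite ?expr0 ?mul1r // exprS -mulrA => /lnz /IH. Qed.

(** Cancelling l^j puts q f_z in (f_x, f_y), so q is the last coordinate of a syzygy; its degree d -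
    1 is too small. *)
Lemma last_coord_pow_eq0 j (q : R) (s : 'rV[R]_3) : s \in syz f ->
  q \is d.-1.-homog -> s 0 o2 = l ^+ j * q -> q = 0.
Proof.
move=> /syzP sS qh s2.
have [a [b abE]] : in_ideal2 (grad f 0 o0) (grad f 0 o1) (q * grad f 0 o2).
  apply: (@nonzerodivisor_pow j); exists (- s 0 o0), (- s 0 o1).
  move: sS; rewrite dotE s2 => E; apply/eqP; rewrite -subr_eq0; apply/eqP.
  by rewrite -[RHS]E; ring.
have tS : row3 (- a) (- b) q \in syz f.
  by apply/syzP; rewrite dotE !row3E abE; ring.
have lt : (d.-1 < d)%N by rewrite prednK.
have := low lt (component_syz fh d.-1 tS).
move/(congr1 (fun v : 'rV[R]_3 => v 0 o2)); rewrite mxE [RHS]mxE row3E.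
by rewrite pihomog_dE.
Qed.

Variable n : nat.

(** The products l^(n+1) q with q of degree d - 1 have degree n + d and meet the last coordinates of
    Syz_(n+d) only in 0, so there is room for a copy of R_(d-1) beside these. *)
Definition omega_poly (x : subvs_of (syz_space f d (n + d)) * V d.-1) : R :=
  vec (vsval x.1) 0 o2 - l ^+ n.+1 * val x.2.

Definition omega x : V (n + d) := to_homog (n + d) (omega_poly x).

Lemma omega_is_linear : linear omega.
Proof.
move=> a x y; apply: etrans (linearP _ a (omega_poly x) (omega_poly y)).
apply: (congr1 (@to_homog _ (n + d))); rewrite /omega_poly.
have -> : vsval (a *: x + y).1 = a *: vsval x.1 + vsval y.1 by [].
have -> : val (a *: x + y).2 = a *: val x.2 + val y.2 by [].
rewrite vec_lin 2!mxE -!mul_mpolyC; ring.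
Qed.
HB.instance Definition _ := GRing.isLinear.Build k _ _ _ omega omega_is_linear.

Lemma omega_homog x : omega_poly x \is (n + d).-homog.
Proof.
apply: rpredB; first exact: vec_homog.
have E : (1 * n.+1 + d.-1 = n + d)%N by rewrite mul1n addSnnS prednK.
by have := dhomogM (dhomogMn n.+1 lh) (dhomog_is_dhomog x.2); rewrite E.
Qed.

Definition koszul_multiples (g : V n) : subvs_of (syz_space f d (n + d)) * V d.-1 :=
  (multiples f d (koszul (grad f) o2) g, 0).

Lemma koszul_multiples_is_linear : linear koszul_multiples.
Proof.
move=> a p q; rewrite /koszul_multiples linearP.
by apply: (congr2 pair) => //=; rewrite scaler0 addr0.
Qed.
HB.instance Definition _ :=
  GRing.isLinear.Build k _ _ _ koszul_multiples koszul_multiples_is_linear.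

Lemma syz_space_le : (\dim (syz_space f d (n + d)) + N d.-1 <= N n + N (n + d))%N.
Proof.
apply: (@dim_kernel_le k (V n) (subvs_of (syz_space f d (n + d)) * V d.-1)%type
  (V (n + d)) koszul_multiples omega) => -[u q] E.
have {}E : vec (vsval u) 0 o2 = l ^+ n.+1 * val q.
  have := congr1 val E; rewrite /= pihomog_dE; last exact: (omega_homog (u, q)).
  by move/eqP; rewrite subr_eq0 => /eqP.
have uS := vec_syz fh u.
have q0 : val q = 0 by apply: last_coord_pow_eq0 uS (dhomog_is_dhomog q) E.
have [g gE] : exists g, vec (vsval u) = g *: koszul (grad f) o2.
  by apply: syz_last0_koszul => //; rewrite E q0 mulr0.
exists (to_homog n g).
rewrite /= /koszul_multiples (multiples_component fh (koszul_graded fh o2) gE).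
by congr pair; apply: val_inj.
Qed.

End LowerBound.

(** * Multiplicity and the theorem *)

Section Multiplicity.
Variable k : fieldType.
Local Notation R := {mpoly k[3]}.

Lemma hilbert_value_pos (I : {pred R}) n h (p : R) :
  is_hilbert_value I n h -> p \is n.-homog -> p \notin I -> (0 < h)%N.
Proof.
move=> [b [_ _ gen]] ph pI; rewrite lt0n; apply: contraNneq pI => h0.
have [c] := gen p ph; rewrite big1 ?subr0 // => i _.
by have := ltn_ord i; rewrite {2}h0.
Qed.

Lemma multiplicity_pos (I : {pred R}) m : idealr_closed I -> is_multiplicity I m ->
  (0 < m)%N.
Proof.
move=> [_ I1 _] [H [P [N [HI HP mE]]]].
have H0 : (0 < H 0)%N by apply: (hilbert_value_pos (HI 0%N) _ I1); apply: dhomog1.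
move: mE; case: (P =P 0) => [P0|/eqP P0] mE.
  case: N HP mE => [|N] HP ->.
    (* The sum is empty for N = 0, but then P = 0 already holds at 0, against H 0 > 0. *)
    by have /eqP := HP 0%N (leqnn 0); rewrite P0 horner0 pnatr_eq0 -leqn0 leqNgt H0.
  by rewrite big_ord_recl addn_gt0 H0.
rewrite lt0n; apply: contraNneq P0 => m0; move: mE; rewrite m0 => /esym/eqP.
by rewrite mulf_eq0 lead_coef_eq0 pnatr_eq0 eqn0Ngt fact_gt0 orbF.
Qed.

(* A polynomial bounded on the naturals is constant: by pigeonhole it takes
   one of finitely many values infinitely often. *)
Lemma bounded_hilbert_poly_const (H : nat -> nat) (P : {poly rat}) (N C : nat) :
  (forall n, (N <= n)%N -> (H n)%:R = P.[n%:R]) ->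
  (forall n, (N <= n)%N -> (H n <= C)%N) -> exists c : nat, P = c%:R%:P.
Proof.
move=> HP HC.
have rat0 : [pchar rat] =i pred0 by apply: pchar_num.
have : \prod_(c < C.+1) (P - c%:R%:P) = 0.
  apply: (@poly_nat_eq0 _ rat0 _ N) => i Ni; rewrite horner_prod.
  have lt : (H i < C.+1)%N by rewrite ltnS HC.
  rewrite (bigD1 (Ordinal lt)) //=.
  by rewrite !hornerE -HP // subrr mul0r.
move/eqP; rewrite prodf_seq_eq0 => /hasP[c _ /= /eqP E]; exists c.
by apply/eqP; rewrite -subr_eq0 E.
Qed.

(** Being bounded, the Hilbert polynomial is a constant c, equal to a value of H beyond degree d;
    the multiplicity is then c itself. *)
Lemma multiplicity_ge (I : {pred R}) m d C :
  (forall n h, is_hilbert_value I n h -> (n < d)%N -> (0 < h)%N) ->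
  (forall n h, is_hilbert_value I n h -> (d <= n)%N -> (d <= h <= C)%N) ->
  is_multiplicity I m -> (d <= m)%N.
Proof.
move=> Hlow Hhigh [H [P [N [HI HP mE]]]].
have [c PE] : exists c : nat, P = c%:R%:P.
  apply: (@bounded_hilbert_poly_const H P (maxn N d) C) => n; rewrite geq_max => /andP[Nn dn].
    exact: HP.
  by have /andP[] := Hhigh _ _ (HI n) dn.
have HM : H (maxn N d) = c.
  have := HP (maxn N d) (leq_maxl _ _); rewrite PE hornerC.
  by move/eqP; rewrite eqr_nat => /eqP.
have dc : (d <= c)%N.
  by rewrite -HM; have /andP[] := Hhigh _ _ (HI (maxn N d)) (leq_maxr _ _).
move: mE; case: (P =P 0) => [P0|/eqP P0] mE.
  by move: dc; have /eqP := P0; rewrite PE polyC_eq0 pnatr_eq0 => /eqP ->; rewrite leqn0 => /eqP ->.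
move: mE; rewrite PE lead_coefC size_polyC.
have -> : (c%:R != 0 :> rat).-1 = 0%N by case: (_ != 0).
by rewrite fact0 mulr1 => /eqP; rewrite eqr_nat => /eqP ->.
Qed.

End Multiplicity.

Lemma bin_add2 n : ('C(n + 2, n) * 2 = n.+2 * n.+1)%N.
Proof.
have -> : 'C(n + 2, n) = 'C(n + 2, 2).
  by rewrite -(bin_sub (leq_addl n 2)) addnK.
by have := bin_ffact (n + 2) 2; rewrite addn2 ffactnS ffactn1.
Qed.

(** * The case e = d *)

Section MaximalIndeg.
Variable k : fieldType.
Hypothesis char0 : [pchar k] =i pred0.
Local Notation R := {mpoly k[3]}.
Variables (f : R) (d : nat).
Hypotheses (fh : f \is d.+1.-homog) (d1 : (1 <= d)%N).

(* When e = d the Hilbert function of R/I lies between d(d+1)/2 and d^2 from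
   degree d on. *)
Lemma bour_ge_of_maximal_indeg eps (I : {pred R}) b :
  is_indeg (syz f) d -> graded_piece (syz f) d eps -> eps != 0 ->
  is_bourbaki_ideal f d d eps I -> is_multiplicity I b -> (d <= b)%N.
Proof.
move=> [_ low] epsS eps0 [Icl _ _ [phi [phiL phiK phiI phiH']]].
have phiH n s : graded_piece (syz f) n s -> phi s \is n.-homog.
  by move=> /phiH'; rewrite subrr addr0.
have [l [l0 lh lnz]] := exists_linear_nonzerodivisor char0
  (grad_coord_neq0 fh d1 low o0) (grad_homog fh o0) (grad01_coprime fh d1 low).
apply: (multiplicity_ge (C := d ^ 2)).
- move=> n h Hn nd; have Xh : ('X_o0 ^+ n : R) \is n.-homog.
    have X1 : ('X_o0 : R) \is 1.-homog by rewrite dhomogX /= mdeg1.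
    by have := dhomogMn n X1; rewrite mul1n.
  apply: (hilbert_value_pos Hn Xh).
  (* The degree n part of I is the image of Syz_n, which is 0 for n < d, so x^n is not in I. *)
  apply/negP => /phiI[s sS sE].
  have := phi_component fh epsS phiL phiK phiH n sS.
  rewrite (low _ nd _ (component_syz fh n sS)) (phi0 epsS phiK) sE pihomog_dE //.
  by move/esym/eqP; rewrite expf_eq0 -msize_poly_eq0 msizeX andbF.
- move=> n' h [b' [bh bfree bgen]] dn; move: bh bgen; rewrite -(subnK dn).
  move: (n' - d)%N => n bh bgen.
  have le := hilbert_value_le fh epsS phiL phiK phiI phiH bh bfree.
  have ge := hilbert_value_ge fh epsS eps0 phiL phiK phiI phiH bh bgen.
  have sle := syz_space_le fh d1 low lh lnz n.
  have sge := dim_syz_space f d (n + d).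
  move: le ge sle sge (bin_add2 n) (bin_add2 (n + d)) (bin_add2 (d + (n + d))) (bin_add2 d.-1).
  set N0 := 'C(n + 2, n); set N1 := 'C(n + d + 2, n + d).
  set N2 := 'C(d + (n + d) + 2, d + (n + d)); set N3 := 'C(d.-1 + 2, d.-1).
  set s := \dim _; clearbody N0 N1 N2 N3 s; rewrite -mulnn.
  move=> le ge sle sge E0 E1 E2 E3.
  have N3h : (N3 <= h)%N by move: ge sle; clear; lia.
  have hN : (h + 2 * N1 <= N0 + N2)%N by move: le sge; clear; lia.
  (* The lower bound is N3 = dim R_(d-1) = d(d+1)/2, at least d; the upper one is N0 - 2 N1 + N2 =
     d^2. *)
  apply/andP; split.
    apply: leq_trans N3h; move: E3; rewrite prednK //.
    by move: (d1); clear; case: d => // j _; rewrite mulnC => E; nia.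
  have second_difference : (n.+2 * n.+1 + (d + (n + d)).+2 * (d + (n + d)).+1
      = 2 * ((n + d).+2 * (n + d).+1) + 2 * (d * d))%N by ring.
  move: second_difference hN; rewrite -E0 -E1 -E2; move: (d * d)%N => dd.
  by clear; lia.
Qed.

End MaximalIndeg.

Lemma minimal_generator_neq0 (k : fieldType) (M : {pred 'rV[{mpoly k[3]}]_3}) n v :
  minimal_generator M n v -> v != 0.
Proof.
move=> [_ H]; apply: contra_notN H => /eqP ->.
exists 0%N, (fun=> 0), (fun=> 0); split=> [|[]|] //; last by rewrite big_ord0.
by move=> i; rewrite mcoeff0.
Qed.

(** The difference of the two sides is (e - 1)(d - 1 - e). *)
Lemma bourbaki_bound_le1 (e d : nat) : (1 <= e)%N -> (e < d)%N ->
  e%:Z * (e%:Z - d%:Z) + d%:Z <= 1.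
Proof. by move=> e1 ed; nia. Qed.

Theorem proposition2p15 (k : closedFieldType) (char0 : [pchar k] =i pred0)
    (f : {mpoly k[3]}) (d e : nat)
    (d_ge1 : (2 <= d.+1)%N) (f_homog : f \is d.+1.-homog)
    (e_indeg : is_indeg (syz f) e) (f_irr : irreducible_elt f) :
  [/\ (* (i) *)
      ~ free_divisor f ->
        forall b : nat, is_bour f d b ->
          e%:Z * (e%:Z - d%:Z) + d%:Z <= b%:Z,
      (* (ii) *)
      [/\ free_divisor f -> (2 <= e)%N /\ (4 <= d)%N,
          (2 <= d.+1 <= 4)%N -> ~ free_divisor f
        & free_divisor f -> d.+1 = 5%N -> e = 2%N]
    & (* (iii) *)
      (2 <= d)%N -> is_bour f d 1 -> (e < d)%N].
Proof.
have f0 : f != 0 by case: f_irr.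
have f_prime : prime_elt f := irreducible_prime (@factorial_mpoly k 3) f_irr.
have e_pos : (0 < e)%N := indeg_neq0 char0 f_irr f_homog d_ge1 e_indeg.
have e_le : (e <= d)%N := indeg_le char0 f0 f_homog e_indeg.
have bour_ge b : is_bour f d b -> ~ free_divisor f ->
    (1 <= b)%N /\ (e = d -> (d <= b)%N).
  case=> [[ffree _] /(_ ffree) //|[_ [e' [eps [I [ind' epsG IB Im]]]]] _].
  have ee := indeg_uniq ind' e_indeg; subst e'; split.
    by case: IB => Icl _ _ _; exact: multiplicity_pos Icl Im.
  move=> ed; subst e.
  exact: (bour_ge_of_maximal_indeg char0 f_homog d_ge1 e_indeg epsG.1 (minimal_generator_neq0 epsG) IB Im).
have free_bound : free_divisor f -> (2 <= e)%N /\ (e + e <= d)%N.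
  move=> ffree; have dd := free_indeg_double char0 f0 f_homog f_prime ffree e_indeg.
  (* From e >= 1 and 2e <= d; the exclusion of e = 1 needs d >= 2, since a smooth conic is
     annihilated by linear fields. *)
  have d2 : (2 <= d)%N by lia.
  have e1 := free_indeg_neq1 char0 f_irr f_homog d_ge1 d2 f_prime ffree e_indeg.
  by split=> //; lia.
split.
- move=> nfree b /bour_ge /(_ nfree)[b1 bd].
  have [ed|ed] := eqVneq e d.
    by have := bd ed; rewrite ed subrr mulr0 add0r lez_nat.
  have := bourbaki_bound_le1 e_pos (_ : (e < d)%N); lia.
- by split; [move=> /free_bound; lia|move=> ? /free_bound; lia|move=> /free_bound; lia].
- move=> d2 B1; rewrite ltn_neqAle e_le andbT; apply/eqP => ed.
  have nfree : ~ free_divisor f by move=> ffree; case: B1 => [[_]|[]].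
  by have [_ /(_ ed)] := bour_ge _ B1 nfree; lia.
Qed.
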